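(* Let $(M,\rho)$ be a compact connected Riemannian manifold without boundary, $\dim M\ge 3$, with $H_1(M;\mathbb{R})\neq 0$, let $P\subset H_1(M;\mathbb{R})$ be an admissible polytope, and let $g$ be an arbitrary Hedlund metric associated to $P$ on $(M,\rho)$. Then $P$ is the unit ball of the stable norm $\|\cdot\|_s$ on $H_1(M;\mathbb{R})$ induced by $g$, i.e. $P=\{w\in H_1(M;\mathbb{R}) : \|w\|_s\le 1\}$.
   Context: **Integer classes.** $H_1(M;\mathbb{Z})_{\mathbb{R}}$ denotes the lattice of integer classes, i.e. the image of $H_1(M;\mathbb{Z})$ in $H_1(M;\mathbb{R})$. A class $v\in H_1(M;\mathbb{Z})_{\mathbb{R}}$ is indivisible if $v=n v'$ with $n\in\mathbb{Z}$, $v'\in H_1(M;\mathbb{Z})_{\mathbb{R}}$ implies $n=\pm1$. A closed curve represents $v\in H_1(M;\mathbb{Z})_{\mathbb{R}}$ if its homology class maps to $v$. $H^1_{dR}(M)$ is identified with the dual of $H_1(M;\mathbb{R})$ by integration. **Stable norm.** For a Riemannian metric $g$ on $M$ with length functional $L$, the stable norm is the norm $\|\cdot\|_s$ on $H_1(M;\mathbb{R})$ given on integer classes $v$ by $\|v\|_s=\inf\{n^{-1}L(\gamma) : n\in\mathbb{N},\ n\ge 1,\ \gamma \text{ a closed curve representing } nv\}$, extended by homogeneity to rational multiples of integer classes and by continuity to $H_1(M;\mathbb{R})$. **Admissible curves and tubular neighborhoods.** An admissible curve is a smooth regular simple closed curve $\gamma:\mathbb{S}^1=\mathbb{R}/\mathbb{Z}\to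 M$, parametrized proportionally to $\rho$-arc length. Given disjoint admissible curves $\gamma_1,\dots,\gamma_N$, set $\Gamma_i=\gamma_i(\mathbb{S}^1)$. Choose $r>0$ such that, for each $i$, the normal exponential map $E$ of $\rho$ restricted to the bundle of open balls of radius $r$ in the normal bundle $N\Gamma_i$ is a diffeomorphism onto an open neighborhood $U_r(\Gamma_i)$ of $\Gamma_i$, and such that these neighborhoods are pairwise disjoint. Choose $0<\varepsilon<r$, let $U_\varepsilon(\Gamma_i)$ be the image of the bundle of open balls of radius $\varepsilon$, and set $\Gamma=\bigcup_i\Gamma_i$, $U_\varepsilon(\Gamma)=\bigcup_i U_\varepsilon(\Gamma_i)$. Let $s_i:U_r(\Gamma_i)\to\mathbb{R}/\mathbb{Z}$ be the map such that $E^{-1}(x)\in N_{\gamma_i(s_i(x))}\Gamma_i$; in particular $s_i(\gamma_i(t))=t$. Its differential $ds_i$ is a well-defined closed 1-form on $U_r(\Gamma_i)$. **Good representatives.** If $\gamma_i$ represents $v_i$ for $i=1,\dots,N$ and the $v_i$ span $H_1(M;\mathbb{R})$, a good representative of $\lambda\in H^1_{dR}(M)$ with respect to $\{v_1,\dots,v_N\}$ is a smooth closed 1-form $\omega$ on $M$ with $[\omega]=\lambda$ and $\omega|_x=\lambda(v_i)\,ds_i|_x$ for all $x\in U_\varepsilon(\Gamma_i)$, $i=1,\dots,N$. **Admissible polytopes.** $P\subset H_1(M;\mathbb{R})$ is admissible if it is a centrally symmetric (about $0$) convex polytope with nonempty interior whose vertices have rational directions, i.e. each vertex is a positive real multiple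 of an integer class. Write its vertices as $\pm\tilde v_1,\dots,\pm\tilde v_N$, and let $v_i=\varepsilon_i\tilde v_i$ with $\varepsilon_i>0$ be the indivisible integer class in the direction of $\tilde v_i$. Let $S_1,\dots,S_l$ be the faces of $P$ of codimension one, and let $\lambda_i\in H^1_{dR}(M)$ be the class with $\lambda_i(\tilde v)=1$ for all vertices $\tilde v\in S_i$ and $\lambda_i(\tilde v)<1$ for all other vertices $\tilde v$ of $P$. **Hedlund metrics.** Choose disjoint admissible curves $\gamma_1,\dots,\gamma_N$ representing $v_1,\dots,v_N$, with radii $0<\varepsilon<r$ such that, for each $i$, the normal exponential map $E$ of $\rho$ restricted to the bundle of open balls of radius $r$ in $N\Gamma_i$ is a diffeomorphism onto the open neighborhood $U_r(\Gamma_i)$ of $\Gamma_i=\gamma_i(\mathbb{S}^1)$, and such that $U_r(\Gamma_1),\dots,U_r(\Gamma_N)$ are pairwise disjoint, and for each $i=1,\dots,l$ a good representative $\eta_i$ of $\lambda_i$ with respect to $\{v_1,\dots,v_N\}$. A Hedlund metric associated to $P$ on $(M,\rho)$ (for such choices) is a smooth Riemannian metric $g$ on $M$, conformal to $\rho$, whose dual metric $g^*$ satisfies: (H1) for all $i\in\{1,\dots,N\}$: $g^*_{\gamma_i(t)}(ds_i,ds_i)=\max_{x\in U_\varepsilon(\Gamma_i)}g^*_x(ds_i,ds_i)=\frac1{\varepsilon_i^2}$ for all $t\in[0,1]$, and $g^*_x(ds_i,ds_i)<\frac1{\varepsilon_i^2}$ for $x\in U_\varepsilon(\Gamma_i)\setminus\Gamma_i$;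 (H2) $g^*_x(\eta_i|_x,\eta_i|_x)\le 1$ for all $i=1,\dots,l$ and all $x\notin U_\varepsilon(\Gamma)$. *)

(* Defs.v *)
From HB Require Import structures.
From mathcomp Require Import all_boot all_order all_algebra.
From mathcomp Require Import ring_quotient.
From mathcomp Require Import all_classical all_reals all_analysis.
From mathcomp Require Import freeg.
Set Implicit Arguments.
Unset Strict Implicit.
Unset Printing Implicit Defensive.
Import Order.TTheory GRing.Theory Num.Theory.
Import numFieldNormedType.Exports.
Local Open Scope classical_set_scope.
Local Open Scope ring_scope.

Definition std_simplex (R : realType) (k : nat) : set 'rV[R]_k.+1 :=
  [set x | (forall i, 0 <= x 0 i) /\ \sum_i x 0 i = 1].
Arguments std_simplex R k : clear implicits.

Section SingularHomology.
Context (R : realType) (T : topologicalType).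

Record sing_simplex (k : nat) := SingSimplex {
  sfun :> set_type (std_simplex R k) -> T;
  sfun_cont : continuous sfun }.

Definition face_row (k : nat) (i : 'I_k.+2) (x : 'rV[R]_k.+1) : 'rV[R]_k.+2 :=
  \row_j (if unlift i j is Some j' then x 0 j' else 0).

Lemma face_row_std (k : nat) (i : 'I_k.+2) (x : set_type (std_simplex R k)) :
  face_row i (set_val x) \in std_simplex R k.+1.
Proof.
rewrite inE; have := set_valP x; set y := set_val x => -[y0 y1]; split.
  by move=> j; rewrite mxE; case: unliftP.
rewrite (bigD1_ord i) //= mxE unlift_none add0r -[RHS]y1.
by apply: eq_bigr => j _; rewrite mxE liftK.
Qed.

Definition face (k : nat) (i : 'I_k.+2) (x : set_type (std_simplex R k)) :
  set_type (std_simplex R k.+1) := exist (fun y => y \in std_simplex R k.+1) _ (face_row_std i x).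

Lemma face_row_cont (k : nat) (i : 'I_k.+2) : continuous (@face_row k i).
Proof.
move=> x A [B Bx BA].
have F (j : 'I_k.+2) : nbhs x [set y | B 0 j (face_row i y 0 j)].
  have := Bx 0 j; rewrite /face_row mxE.
  case E: (unlift i j) => [j'|] Bj.
    have := @coord_continuous _ 1 k.+1 0 j' x _ Bj.
    by rewrite nbhs_simpl /=; apply: filterS => y; rewrite /= mxE E.
  apply: (filterS _ filterT) => y _; rewrite /= mxE E; exact: nbhs_singleton Bj.
have := filter_forall (@nbhs_filter _ x) F.
rewrite nbhs_simpl /=; apply: (@filterS _ (nbhs x)) => y By.
by apply: BA => a b; rewrite (ord1 a).
Qed.

Lemma face_cont (k : nat) (i : 'I_k.+2) : continuous (@face k i).
Proof.
apply: continuous_comp_initial => x.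
apply: (@continuous_comp _ _ _ set_val (@face_row k i)).
  exact: initial_continuous.
exact: face_row_cont.
Qed.

Lemma sface_cont (k : nat) (s : sing_simplex k.+1) (i : 'I_k.+2) :
  continuous (s \o face i).
Proof.
by move=> x; apply: continuous_comp; [exact: face_cont|exact: sfun_cont].
Qed.

Definition sface (k : nat) (s : sing_simplex k.+1) (i : 'I_k.+2) :
  sing_simplex k := SingSimplex (@sface_cont k s i).

Definition chain (k : nat) : lmodType R := {freeg {classic sing_simplex k} / R}.

Definition bdry_simplex (k : nat) (s : sing_simplex k.+1) : chain k :=
  \sum_(i < k.+2) (-1) ^+ i *: << (sface s i : {classic sing_simplex k}) >>.

Definition bdry (k : nat) (c : chain k.+1) : chain k :=
  fglift (@bdry_simplex k : {classic sing_simplex k.+1} -> chain k) c.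

Lemma bdry_is_linear (k : nat) : linear (@bdry k).
Proof.
have addB : additive (@bdry k).
  by move=> c d; apply: (@lift_is_additive _ _ (chain k) _ c d).
pose B := HB.pack_for {additive chain k.+1 -> chain k} (@bdry k)
  (GRing.isZmodMorphism.Build _ _ (@bdry k) addB).
have B1 : B = @bdry k :> (_ -> _) by [].
move=> a c d; rewrite -B1 raddfD; congr (_ + _).
have cE : c = \sum_(s <- dom c) << coeff s c *g s >> by rewrite freeg_sumE.
have -> : a *: c = \sum_(s <- dom c) << (a * coeff s c) *g s >>.
  rewrite [X in a *: X]cE (@scaler_sumr R (chain k.+1)).
  apply: eq_bigr => s _.
  by apply/eqP/freeg_eqP => z; rewrite coeffZ !coeffU mulrA.
rewrite [in RHS]cE !raddf_sum; apply: eq_bigr => s _ /=.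
by rewrite /bdry !liftU scalerA.
Qed.

HB.instance Definition _ (k : nat) :=
  GRing.isLinear.Build R (chain k.+1) (chain k) _ (@bdry k) (@bdry_is_linear k).

Definition is_cycle1 : {pred chain 1} := fun c => bdry c == 0.

Lemma is_cycle1_submod : submod_closed is_cycle1.
Proof.
split=> [|a c d]; rewrite !unfold_in ?linear0 // => /eqP c0 /eqP d0.
by rewrite linearP /= c0 d0 scaler0 addr0.
Qed.

HB.instance Definition _ :=
  GRing.isSubmodClosed.Build R (chain 1) is_cycle1 is_cycle1_submod.

Record cycle1 := Cycle1 { cycle_chain : chain 1; _ : cycle_chain \in is_cycle1 }.

HB.instance Definition _ := [isSub for cycle_chain].
HB.instance Definition _ := [Choice of cycle1 by <:].
HB.instance Definition _ := [SubChoice_isSubLmodule of cycle1 by <:].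

Definition boundary1 : {pred cycle1} :=
  fun z => `[< exists b : chain 2, bdry b = val z >].

Lemma boundary1_submod : submod_closed boundary1.
Proof.
split=> [|a y z]; rewrite !unfold_in.
  by apply/asboolP; exists 0; rewrite !linear0.
move=> /asboolP[b bE] /asboolP[c cE]; apply/asboolP; exists (a *: b + c).
by rewrite !linearP /= bE cE.
Qed.

HB.instance Definition _ :=
  GRing.isSubmodClosed.Build R cycle1 boundary1 boundary1_submod.

Definition H1 : Type := Quotient.quot boundary1.

HB.instance Definition _ := GRing.Zmodule.on H1.

Definition hclass (z : cycle1) : H1 := \pi_(Quotient.quot boundary1)%qT z.

Lemma hclassP (y z : cycle1) : hclass y = hclass z <-> y - z \in boundary1.
Proof.
by rewrite Quotient.idealrBE; split=> [/eqP|/eqP].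
Qed.

Lemma hclass_add : {morph hclass : y z / y + z}.
Proof. by move=> y z; rewrite /hclass raddfD. Qed.

Definition hrepr (x : H1) : cycle1 := repr (x : Quotient.quot boundary1).

Lemma hreprK : cancel hrepr hclass.
Proof. by move=> x; rewrite /hclass /hrepr reprK. Qed.

Definition hscale (a : R) (x : H1) : H1 := hclass (a *: hrepr x).

Lemma hscale_class (a : R) (z : cycle1) : hscale a (hclass z) = hclass (a *: z).
Proof.
apply/hclassP; rewrite -scalerBr rpredZ //.
by apply/hclassP; rewrite hreprK.
Qed.

Lemma hscaleA (a b : R) (x : H1) : hscale a (hscale b x) = hscale (a * b) x.
Proof. by rewrite -(hreprK x) !hscale_class scalerA. Qed.

Lemma hscale1 : left_id 1 hscale.
Proof. by move=> x; rewrite -(hreprK x) !hscale_class scale1r. Qed.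

Lemma hscaleDr : right_distributive hscale +%R.
Proof.
move=> a x y; rewrite -(hreprK x) -(hreprK y).
by rewrite -hclass_add !hscale_class scalerDr hclass_add.
Qed.

Lemma hscaleDl (x : H1) : {morph hscale^~ x : a b / a + b}.
Proof.
by move=> a b; rewrite -(hreprK x) !hscale_class scalerDl hclass_add.
Qed.

HB.instance Definition _ :=
  GRing.Zmodule_isLmodule.Build R H1 hscaleA hscale1 hscaleDr hscaleDl.

(* The image of H_1(T; Z): an integral chain is a cycle over Z iff it is one
   over R. *)
Definition integer_class (v : H1) : Prop :=
  exists z : cycle1, (forall s, coeff s (val z) \is a Num.int) /\ v = hclass z.

Definition indivisible (v : H1) : Prop :=
  integer_class v /\ forall (n : int) (v' : H1),
    integer_class v' -> v = n%:~R *: v' -> n = 1 \/ n = -1.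

(* gamma, restricted to [0, 1], is a closed curve and v is the class of the
   singular simplex (1 - t, t) |-> gamma t. *)
Definition represents (gamma : R -> T) (v : H1) : Prop :=
  exists (s : sing_simplex 1) (z : cycle1),
  [/\ forall x, s x = gamma (set_val x 0 ord_max),
      val z = << (s : {classic sing_simplex 1}) >> & v = hclass z].

End SingularHomology.

Section Polytopes.
Context (R : realType) (V : lmodType R).
Implicit Types (P F : set V) (x y v w : V).

(* The topology of a finite-dimensional real vector space, without a choice of
   basis: the finest one for which all linear maps from R^k are continuous. *)
Definition vopen (U : set V) : Prop :=
  forall (k : nat) (f : {linear 'rV[R]_k -> V}), open (f @^-1` U).

Definition nonempty_interior P : Prop :=
  exists U : set V, [/\ vopen U, U !=set0 & U `<=` P].

Definition polytope P : Prop :=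
  exists (m : nat) (p : 'I_m -> V),
    P = [set x | exists a : 'I_m -> R,
      [/\ forall i, 0 <= a i, \sum_i a i = 1 & x = \sum_i a i *: p i]].

Definition vertex P v : Prop :=
  P v /\ forall x y (t : R), P x -> P y -> 0 < t < 1 ->
    v = t *: x + (1 - t) *: y -> x = v /\ y = v.

Definition face_of P F : Prop :=
  F !=set0 /\ exists (f : {scalar V}) (c : R),
    (forall x, P x -> f x <= c) /\ F = [set x | P x /\ f x = c].

(* Linear span of the differences of elements of F: the direction of the affine
   hull of F. *)
Definition direction F : set V :=
  [set w | exists (m : nat) (a : 'I_m -> R) (x y : 'I_m -> V),
    (forall i, F (x i) /\ F (y i)) /\ w = \sum_i a i *: (x i - y i)].

Definition codim1 (W : set V) : Prop :=
  exists w, ~ W w /\ forall x, exists a : R, W (x - a *: w).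

Definition facet P F : Prop := face_of P F /\ codim1 (direction F).

End Polytopes.

Section AdmissiblePolytope.
Context (R : realType) (T : topologicalType).

Record admissible_polytope (P : set (H1 R T)) : Prop := AdmissiblePolytope {
  adm_polytope : polytope P;
  adm_sym : forall x, P x -> P (- x);
  adm_int : nonempty_interior P;
  adm_rat : forall v, vertex P v ->
    exists (c : R) (u : H1 R T), [/\ 0 < c, integer_class u & v = c *: u] }.

End AdmissiblePolytope.

Section Smooth.
Context (R : realType).

Fixpoint Ck (V W : normedModType R) (k : nat) (A : set V) (f : V -> W) : Prop :=
  if k is k'.+1 then
    (forall x, A x -> differentiable f x) /\ forall v, Ck k' A ('D_v f)
  else forall x, A x -> {for x, continuous f}.

(* Only used for open A. *)
Definition smooth_on (V W : normedModType R) (A : set V) (f : V -> W) : Prop :=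
  forall k, Ck k A f.

End Smooth.

Record chart (R : realType) (n : nat) (M : topologicalType) := Chart {
  cdom : set M;
  coord : M -> 'rV[R]_n;
  icoord : 'rV[R]_n -> M;
  cdom_open : open cdom;
  img_open : open (coord @` cdom);
  coordK : forall x, cdom x -> icoord (coord x) = x;
  coord_cont : forall x, cdom x -> {for x, continuous coord};
  icoord_cont : forall p, (coord @` cdom) p -> {for p, continuous icoord} }.

Definition img (R : realType) (n : nat) (M : topologicalType)
  (c : chart R n M) : set 'rV[R]_n := coord c @` cdom c.

(* A smooth n-manifold without boundary. chart_at selects a chart around each
   point; the tangent space at x is identified with R^n by the chart
   chart_at x. *)
Record manifold (R : realType) (n : nat) (M : topologicalType) := Manifold {
  charts : set (chart R n M);
  chart_at : M -> chart R n M;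
  chart_atP : forall x, charts (chart_at x) /\ cdom (chart_at x) x;
  transition : forall c d, charts c -> charts d ->
    smooth_on (coord c @` (cdom c `&` cdom d)) (coord d \o icoord c);
  manifold_hausdorff : hausdorff_space M }.

Section Manifold.
Context (R : realType) (n : nat) (M : topologicalType) (X : manifold R n M).
Implicit Types (c d : chart R n M) (x y : M) (gamma : R -> M).

Definition base (i : 'I_n) : 'rV[R]_n := delta_mx 0 i.

(* The differential of the chart c at x, on the tangent space at x. *)
Definition dcoord c x (v : 'rV[R]_n) : 'rV[R]_n :=
  'd (coord c \o icoord (chart_at X x)) (coord (chart_at X x) x) v.

(* The differential of the inverse of the chart c at p. *)
Definition dicoord c (p u : 'rV[R]_n) : 'rV[R]_n :=
  'd (coord (chart_at X (icoord c p)) \o icoord c) p u.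

(* U is open in the following definitions. *)

Definition smooth_fun (W : normedModType R) (U : set M) (f : M -> W) : Prop :=
  forall c, charts X c -> smooth_on (coord c @` (cdom c `&` U)) (f \o icoord c).

Definition smooth_into (V : normedModType R) (U : set V) (f : V -> M) : Prop :=
  (forall p, U p -> {for p, continuous f}) /\
  forall c, charts X c -> smooth_on (U `&` f @^-1` cdom c) (coord c \o f).

(* Tangent vectors are pairs (x, v) with v in the tangent space at x; these are
   the coordinates of (x, v) in the chart of TM induced by c. *)
Definition tcoord c (q : M * 'rV[R]_n) : 'rV[R]_n * 'rV[R]_n :=
  (coord c q.1, dcoord c q.1 q.2).

Definition smooth_into_TM (U : set M) (F : M -> M * 'rV[R]_n) : Prop :=
  (forall x, U x -> {for x, continuous (fst \o F)}) /\
  forall c d, charts X c -> charts X d ->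
    smooth_on (coord d @` (cdom d `&` U `&` [set x | cdom c (F x).1]))
      (tcoord c \o F \o icoord d).

(* Smoothness of a map on a submanifold D of TM: local smooth extensions. *)
Definition smooth_on_TM (D : set (M * 'rV[R]_n)) (f : M * 'rV[R]_n -> M) : Prop :=
  forall q, D q -> exists (c d : chart R n M)
    (O : set ('rV[R]_n * 'rV[R]_n)) (G : 'rV[R]_n * 'rV[R]_n -> 'rV[R]_n),
  [/\ [/\ charts X c, charts X d, cdom c q.1 & cdom d (f q)],
      open O, O (tcoord c q), smooth_on O G &
      forall q', D q' -> cdom c q'.1 -> O (tcoord c q') ->
        cdom d (f q') /\ coord d (f q') = G (tcoord c q')].

Definition velocity gamma (t : R) : 'rV[R]_n :=
  derive1 (coord (chart_at X (gamma t)) \o gamma) t.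

Definition pairing (v : 'rV[R]_n) (a : 'cV[R]_n) : R := (v *m a) 0 0.

Definition form_coord c (w : M -> 'cV[R]_n) (p : 'rV[R]_n) : 'cV[R]_n :=
  \col_i pairing (dicoord c p (base i)) (w (icoord c p)).

Definition smooth_form (w : M -> 'cV[R]_n) : Prop :=
  forall c, charts X c -> smooth_on (img c) (form_coord c w).

Definition closed_form (w : M -> 'cV[R]_n) : Prop :=
  forall c, charts X c -> forall p, img c p -> forall i j,
    'D_(base i) (fun q => form_coord c w q j 0) p =
    'D_(base j) (fun q => form_coord c w q i 0) p.

Definition differential (f : M -> R) (x : M) : 'cV[R]_n :=
  \col_i 'D_(base i) (f \o icoord (chart_at X x)) (coord (chart_at X x) x).

Definition piecewise_smooth gamma : Prop :=
  exists (m : nat) (a : nat -> R),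
  [/\ a 0%N = 0, a m = 1 &
      forall i, (i < m)%N -> a i < a i.+1 /\
        exists (O : set R) (sigma : R -> M),
        [/\ open O, `[a i, a i.+1] `<=` O, smooth_into O sigma &
            forall t, a i <= t <= a i.+1 -> gamma t = sigma t]].

Definition closed_curve gamma : Prop :=
  piecewise_smooth gamma /\ gamma 0 = gamma 1.

Definition line_integral (w : M -> 'cV[R]_n) gamma : R :=
  \int[lebesgue_measure]_(t in `[0, 1]) pairing (velocity gamma t) (w (gamma t)).

(* [w] = lam under the identification of the first de Rham cohomology with the
   dual of H_1(M; R) by integration. *)
Definition de_rham_class (w : M -> 'cV[R]_n) (lam : {scalar H1 R M}) : Prop :=
  forall gamma v, closed_curve gamma -> represents gamma v ->
    line_integral w gamma = lam v.

Definition metric := M -> 'M[R]_n.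
Implicit Types g rho : metric.

Definition inner g x (u v : 'rV[R]_n) : R := (u *m g x *m v^T) 0 0.

Definition dual_norm2 g x (a : 'cV[R]_n) : R := (a^T *m invmx (g x) *m a) 0 0.

Definition metric_coord c g (p : 'rV[R]_n) : 'M[R]_n :=
  \matrix_(i, j) inner g (icoord c p) (dicoord c p (base i)) (dicoord c p (base j)).

Record riemannian g : Prop := Riemannian {
  riem_sym : forall x, (g x)^T = g x;
  riem_pos : forall x v, v != 0 -> 0 < inner g x v v;
  riem_smooth : forall c, charts X c -> smooth_on (img c) (metric_coord c g) }.

Definition conformal g rho : Prop :=
  exists f : M -> R, [/\ smooth_fun setT f, forall x, 0 < f x &
    forall x, g x = f x *: rho x].

Definition speed g gamma (t : R) : R :=
  Num.sqrt (inner g (gamma t) (velocity gamma t) (velocity gamma t)).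

Definition curve_length g gamma : R :=
  \int[lebesgue_measure]_(t in `[0, 1]) speed g gamma t.

(* Christoffel symbols, with k the upper index. *)
Definition christoffel c g (p : 'rV[R]_n) (k i j : 'I_n) : R :=
  2^-1 * \sum_l invmx (metric_coord c g p) k l *
    ('D_(base i) (fun q => metric_coord c g q j l) p +
     'D_(base j) (fun q => metric_coord c g q i l) p -
     'D_(base l) (fun q => metric_coord c g q i j) p).

Definition geodesic g gamma : Prop :=
  smooth_into setT gamma /\
  forall c t, charts X c -> cdom c (gamma t) -> forall k,
    let u : R -> 'rV[R]_n := coord c \o gamma in
    (derive1n 2 u t) 0 k +
      \sum_i \sum_j christoffel c g (u t) k i j * (derive1 u t) 0 i * (derive1 u t) 0 j = 0.

(* The exponential map is the unique E such that t |-> E (x, t v) is the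
   geodesic with initial velocity (x, v); it exists for complete metrics. *)
Definition is_exp g (E : M * 'rV[R]_n -> M) : Prop :=
  forall x v, let gamma := fun t : R => E (x, t *: v) in
    [/\ geodesic g gamma, gamma 0 = x & velocity gamma 0 = v].

Definition exp_map g : M * 'rV[R]_n -> M := @xget (M * 'rV[R]_n -> M)%type fst (is_exp g).

Definition stable_value g (v : H1 R M) : R :=
  inf [set r | exists (m : nat) (gamma : R -> M),
    [/\ (0 < m)%N, closed_curve gamma, represents gamma (m%:R *: v) &
        r = m%:R^-1 * curve_length g gamma]].

(* A norm on the finite-dimensional space H_1(M; R) is continuous and
   homogeneous, hence determined by its values on the integer classes. *)
Record is_stable_norm g (N : H1 R M -> R) : Prop := IsStableNorm {
  stable_triangle : forall v w, N (v + w) <= N v + N w;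
  stable_scale : forall (a : R) v, N (a *: v) = `|a| * N v;
  stable_eq0 : forall v, N v = 0 -> v = 0;
  stable_integer : forall v, integer_class v -> N v = stable_value g v }.

(* A closed curve R/Z -> M is a 1-periodic map R -> M. *)
Record admissible_curve rho gamma : Prop := AdmissibleCurve {
  adm_periodic : forall t, gamma (t + 1) = gamma t;
  adm_smooth : smooth_into setT gamma;
  adm_regular : forall t, velocity gamma t != 0;
  adm_simple : forall s t, gamma s = gamma t -> s - t \is a Num.int;
  adm_speed : forall s t, speed rho gamma s = speed rho gamma t }.

Definition normal_vector rho gamma (r t : R) (v : 'rV[R]_n) : Prop :=
  inner rho (gamma t) v (velocity gamma t) = 0 /\
  Num.sqrt (inner rho (gamma t) v v) < r.

Definition normal_disc rho gamma (r : R) : set (M * 'rV[R]_n) :=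
  [set q | exists t, q.1 = gamma t /\ normal_vector rho gamma r t q.2].

Definition tube rho gamma (r : R) : set M :=
  exp_map rho @` normal_disc rho gamma r.

(* The normal exponential map is a diffeomorphism from the bundle of open
   r-balls of the normal bundle onto an open set. *)
Record tubular rho gamma (r : R) : Prop := Tubular {
  tub_open : open (tube rho gamma r);
  tub_smooth : smooth_on_TM (normal_disc rho gamma r) (exp_map rho);
  tub_inverse : exists F : M -> M * 'rV[R]_n,
    (forall q, normal_disc rho gamma r q -> F (exp_map rho q) = q) /\
    smooth_into_TM (tube rho gamma r) F }.

(* t is a representative in R of s(x), where s : U_r -> R/Z. *)
Definition foot rho gamma (r : R) x (t : R) : Prop :=
  exists v, normal_vector rho gamma r t v /\ x = exp_map rho (gamma t, v).

(* The differential of s at x, computed from a smooth lift of s to R near x. *)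
Definition ds rho gamma (r : R) x : 'cV[R]_n :=
  xget 0 [set a | exists (O : set M) (s : M -> R),
    [/\ open O, O x, smooth_fun O s, forall y, O y -> foot rho gamma r y (s y) &
        a = differential s x]].

Record good_representative rho (N : nat) (gamma : 'I_N -> R -> M)
  (v : 'I_N -> H1 R M) (r eps : R) (lam : {scalar H1 R M})
  (w : M -> 'cV[R]_n) : Prop := GoodRepresentative {
  good_smooth : smooth_form w;
  good_closed : closed_form w;
  good_class : de_rham_class w lam;
  good_tube : forall i x, tube rho (gamma i) eps x ->
    w x = lam (v i) *: ds rho (gamma i) r x }.

(* The choices made in the definition of a Hedlund metric associated to P. *)
Record hedlund_data (P : set (H1 R M)) rho := HedlundData {
  nv : nat;
  vtx : 'I_nv -> H1 R M;
  scl : 'I_nv -> R;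
  vint : 'I_nv -> H1 R M;
  nf : nat;
  fct : 'I_nf -> set (H1 R M);
  lam : 'I_nf -> {scalar H1 R M};
  crv : 'I_nv -> R -> M;
  rad : R;
  eps : R;
  eta : 'I_nf -> M -> 'cV[R]_n;
  vtx_inj : injective vtx;
  vtx_opp : forall i j, vtx i <> - vtx j;
  vtxP : forall v, vertex P v <-> exists i, v = vtx i \/ v = - vtx i;
  scl_gt0 : forall i, 0 < scl i;
  vintE : forall i, vint i = scl i *: vtx i;
  vint_indivisible : forall i, indivisible (vint i);
  fct_inj : injective fct;
  fctP : forall F, facet P F <-> exists i, F = fct i;
  lam_eq1 : forall i v, vertex P v -> fct i v -> lam i v = 1;
  lam_lt1 : forall i v, vertex P v -> ~ fct i v -> lam i v < 1;
  crv_admissible : forall i, admissible_curve rho (crv i);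
  crv_represents : forall i, represents (crv i) (vint i);
  crv_disjoint : forall i j, i != j -> range (crv i) `&` range (crv j) = set0;
  eps_rad : 0 < eps < rad;
  crv_tubular : forall i, tubular rho (crv i) rad;
  tube_disjoint : forall i j, i != j ->
    tube rho (crv i) rad `&` tube rho (crv j) rad = set0;
  eta_good : forall i, good_representative rho crv vint rad eps (lam i) (eta i) }.

Arguments scl {P rho} h i.
Arguments crv {P rho} h i.
Arguments eta {P rho} h i.

Record hedlund_metric (P : set (H1 R M)) rho (h : hedlund_data P rho) g : Prop :=
  HedlundMetric {
  hed_riemannian : riemannian g;
  hed_conformal : conformal g rho;
  hed_core : forall i t, 0 <= t <= 1 ->
    dual_norm2 g (crv h i t) (ds rho (crv h i) (rad h) (crv h i t)) =
      (scl h i ^+ 2)^-1;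
  hed_max : forall i x, tube rho (crv h i) (eps h) x ->
    dual_norm2 g x (ds rho (crv h i) (rad h) x) <= (scl h i ^+ 2)^-1;
  hed_strict : forall i x, tube rho (crv h i) (eps h) x ->
    ~ range (crv h i) x ->
    dual_norm2 g x (ds rho (crv h i) (rad h) x) < (scl h i ^+ 2)^-1;
  hed_outside : forall j x, (forall i, ~ tube rho (crv h i) (eps h) x) ->
    dual_norm2 g x (eta h j x) <= 1 }.

End Manifold.

(* Main.v *)
Require Import Defs.
From HB Require Import structures.
From mathcomp Require Import all_boot all_order all_algebra.
From mathcomp Require Import all_classical all_reals all_analysis.
From mathcomp Require Import ring lra zify.
From mathcomp Require freeg.
Set Implicit Arguments.
Unset Strict Implicit.
Unset Printing Implicit Defensive.
Import Order.TTheory GRing.Theory Num.Theory.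
Import numFieldNormedType.Exports.
(* From here on, coord is the coordinate map of a chart, not that of a basis. *)
Import Defs.
Local Open Scope classical_set_scope.
Local Open Scope ring_scope.

(** The stable norm is squeezed between the gauge of P and the largest of the
facet functionals lam_j, and these two agree because P is cut out by its facets.

P is contained in the unit ball. Along the core curve gamma_i the covector ds_i
takes the value 1 on the velocity and vanishes on its orthogonal complement
([differential_lift_velocity], [differential_lift_normal]), so the dual norm
1/eps_i of ds_i prescribed by (H1) is the inverse of the speed of gamma_i; here
conformality makes the orthogonal complements for g and rho the same
([core_speed]). Hence gamma_i has length eps_i, the class v_i = eps_i v~_i has
stable norm at most eps_i, and every vertex of P has norm at most 1. A polytope
is the hull of its vertices ([polytope_vertices]), and the norm is convex.

The unit ball is contained in P. The form eta_j calibrates: its dual norm is at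
most 1 everywhere, by (H2) outside the tubes and inside them by (H1) together
with the bound |lam_j| <= 1 on the vertices ([dual_norm_eta]). Integrating eta_j
over a closed curve that represents m v gives m lam_j(v) <= L
([line_integral_le], [lam_le_length]), so lam_j <= N on the integer classes, and
then everywhere because the integer classes span ([scalar_le_of_int_comb]). If w
is not in P, there is a facet of P whose functional exceeds 1 at w
([polytope_facet]); this functional is some lam_j, so N w > 1.

The facet is found from a separating functional f with f <= 1 on P and
f w > 1, which Farkas' lemma provides. As long as the vertices with f = 1 do
not span the space, f can be moved along a functional that vanishes on all of
them until one more vertex becomes tight, without decreasing f w
([tighten_functional]). *)

(** * Convex geometry *)

Section Farkas.
Context (R : realType).
Implicit Types V X : lmodType R.

Definition scalar_of V (f : V -> R) (f_lin : scalar f) : {scalar V} :=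
  HB.pack f (GRing.isLinear.Build R V R _ f f_lin).

Definition coord_scalar V d (c : {linear V -> 'rV[R]_d}) (b : 'cV[R]_d) (x : V) : R :=
  (c x *m b) 0 0.

Lemma coord_scalar_linear V d (c : {linear V -> 'rV[R]_d}) b :
  scalar (coord_scalar c b).
Proof. by move=> a x y; rewrite /coord_scalar linearP mulmxDl -scalemxAl !mxE. Qed.

(** Induction on the number of constraints. When dropping the constraint al
makes the implication fail at some x0, then al x0 > 0, and projecting along x0
onto the kernel of al reduces to the remaining constraints; the choice of x0 makes
the coefficient of al nonnegative. *)
Lemma farkas X m (A : 'I_m -> X -> R) (c : X -> R) :
  (forall i, scalar (A i)) -> scalar c ->
  (forall x, (forall i, A i x <= 0) -> c x <= 0) ->
  exists l : 'I_m -> R,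
    (forall i, 0 <= l i) /\ forall x, c x = \sum_i l i * A i x.
Proof.
elim: m A c => [|m IH] A c Alin clin H.
  exists (fun=> 0); split=> // x; rewrite big_ord0; apply/eqP.
  have c0 y : c y <= 0 by apply: H => -[].
  rewrite eq_le c0 /=; have := c0 (- x).
  by rewrite -[c]/(scalar_of clin : X -> R) linearN oppr_le0.
pose al := A ord0; pose A' i := A (lift ord0 i).
have [H'|/existsNP[x0 /not_implyP[A'x0 cx0]]] :=
    pselect (forall x, (forall i, A' i x <= 0) -> c x <= 0).
  have [l [l0 lE]] := IH A' c (fun i => Alin _) clin H'.
  exists (fun i => if unlift ord0 i is Some j then l j else 0); split.
    by move=> i; case: unliftP.
  move=> x; rewrite big_ord_recl unlift_none mul0r add0r lE.
  by apply: eq_bigr => i _; rewrite liftK.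
have al0 : 0 < al x0.
  rewrite ltNge; apply/negP => al0; apply: cx0; apply: H => i.
  by case: (unliftP ord0 i) => [j ->|->//]; exact: A'x0.
have {}cx0 : 0 < c x0 by rewrite ltNge; apply/negP.
(* The projection along x0 onto the kernel of al. *)
pose y x := x - (al x / al x0) *: x0.
have ylin a u v : y (a *: u + v) = a *: y u + y v.
  have allin : scalar al := Alin ord0.
  rewrite /y allin scalerBr scalerA mulrDl scalerDl -mulrA.
  by rewrite opprD addrACA.
have comp_lin (f : X -> R) : scalar f -> scalar (f \o y).
  by move=> f_lin a u v; rewrite /= ylin f_lin.
have yE (f : X -> R) : scalar f -> forall x, f (y x) = f x - al x / al x0 * f x0.
  by move=> fl x; rewrite -[f]/(scalar_of fl : X -> R) linearB linearZ.
have [||x Hx|l [l0 lE]] := IH (fun i => A' i \o y) (c \o y).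
- by move=> i; apply: comp_lin; exact: Alin.
- exact: comp_lin.
- apply: H => i; case: (unliftP ord0 i) => [j ->|->]; first exact: Hx.
  by rewrite yE // -/al divfK ?subrr // gt_eqF.
(* The coefficient of al: what the projection y removes from c, minus what it
   removes from the combination of the other constraints. *)
pose b := c x0 / al x0 - \sum_i l i * (A' i x0 / al x0).
exists (fun i => if unlift ord0 i is Some j then l j else b); split.
  move=> i; case: unliftP => // _.
  rewrite subr_ge0 (@le_trans _ _ 0) //; last by rewrite divr_ge0 // ltW.
  apply: sumr_le0 => j _; rewrite mulr_ge0_le0 // mulr_le0_ge0 //.
  by rewrite invr_ge0 ltW.
move=> x; rewrite big_ord_recl unlift_none -/al.
under eq_bigr => i _ do rewrite liftK -/(A' i).
have := lE x; rewrite /= yE //.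
have -> : \sum_(i < m) l i * A' i (y x) =
    \sum_(i < m) l i * A' i x - (\sum_i l i * (A' i x0 / al x0)) * al x.
  rewrite mulr_suml -sumrB; apply: eq_bigr => i _.
  by rewrite yE; [ring|exact: Alin].
by rewrite /b => /eqP; rewrite subr_eq => /eqP ->; ring.
Qed.

End Farkas.

Section Convex.
Context (R : realType) (V : lmodType R).

Definition spans m (u : 'I_m -> V) : Prop :=
  forall x, exists a : 'I_m -> R, x = \sum_i a i *: u i.

Definition hull m (p : 'I_m -> V) : set V :=
  [set x | exists a : 'I_m -> R,
    [/\ forall i, 0 <= a i, \sum_i a i = 1 & x = \sum_i a i *: p i]].

(** A dependent spanning family can be shortened; an independent one gives
unique, hence linear, coefficients. *)
Lemma spans_coord m (u : 'I_m -> V) : spans u ->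
  exists d (c : {linear V -> 'rV[R]_d}),
    injective c /\ forall y, exists x, c x = y.
Proof.
elim: m u => [|m IH] u sp.
  have lin0 : linear (fun _ : V => 0 : 'rV[R]_0) by move=> a x y; rewrite scaler0 addr0.
  pose c : {linear V -> 'rV[R]_0} := HB.pack (fun _ : V => 0 : 'rV[R]_0)
    (GRing.isLinear.Build R V _ _ _ lin0).
  exists 0%N, c; split=> [x y _|y]; last by exists 0; apply/rowP => -[].
  by have [[a ->] [b ->]] := (sp x, sp y); rewrite !big_ord0.
have [free|/existsNP[a /not_implyP[a0 /existsNP[k /eqP ak]]]] :=
    pselect (forall a : 'I_m.+1 -> R, \sum_i a i *: u i = 0 -> forall i, a i = 0).
  have [a aE] := choice sp.
  have lin : linear (fun x => \row_i a x i).
    move=> t x y; apply/rowP => i; rewrite !mxE; apply/eqP; rewrite -subr_eq0.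
    apply/eqP; move: i; apply: free.
    under eq_bigr => i _ do rewrite scalerBl scalerDl -scalerA.
    by rewrite sumrB big_split /= -scaler_sumr -!aE subrr.
  pose c : {linear V -> 'rV[R]_m.+1} := HB.pack (fun x => \row_i a x i)
    (GRing.isLinear.Build R V _ _ _ lin).
  exists m.+1, c; split=> [x y /rowP cxy|y].
    rewrite (aE x) (aE y); apply: eq_bigr => i _.
    by have := cxy i; rewrite !mxE => ->.
  exists (\sum_i y 0 i *: u i); apply/rowP => i; rewrite mxE.
  set x := \sum_i _; apply/eqP; rewrite -subr_eq0; apply/eqP; move: i.
  by apply: free; under eq_bigr => i _ do rewrite scalerBl; rewrite sumrB -aE subrr.
apply: (IH (fun i => u (lift k i))) => x; have [b ->] := sp x.
exists (fun i => b (lift k i) - b k * (a (lift k i) / a k)).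
have : u k = - \sum_i (a (lift k i) / a k) *: u (lift k i).
  move: a0; rewrite (bigD1_ord k) //= => /eqP; rewrite addr_eq0 => /eqP a0.
  rewrite -[u k]scale1r -(mulVf ak) -scalerA a0 scalerN; congr (- _).
  by rewrite scaler_sumr; apply: eq_bigr => i _; rewrite scalerA mulrC.
rewrite (bigD1_ord k) //= => ->.
under [RHS]eq_bigr => i _ do rewrite scalerBl -scalerA.
by rewrite sumrB -scaler_sumr scalerN addrC.
Qed.

(** Farkas' lemma on the space of affine functionals, encoded as pairs of a
linear part b and a threshold t; each point x of the space acts on it by
(b, t) |-> b x - t. *)
Lemma hull_separation d (c : {linear V -> 'rV[R]_d}) m (p : 'I_m -> V) w :
  injective c -> ~ hull p w ->
  exists (f : {scalar V}) (t : R), (forall i, f (p i) <= t) /\ t < f w.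
Proof.
move=> c_inj; apply: contra_notP => /forallNP H.
pose F x (bt : 'cV[R]_d * R^o) : R := coord_scalar c bt.1 x - bt.2.
have Flin x : scalar (F x).
  move=> a [b s] [b' s']; rewrite /F /coord_scalar /= mulmxDr -scalemxAr !mxE.
  rewrite /GRing.scale /=; ring.
have [|l [l0 lE]] := farkas (fun i => Flin (p i)) (Flin w).
  move=> [b t] bt; rewrite leNgt; apply/negP => wt.
  apply: (H (scalar_of (coord_scalar_linear c b))); exists t => /=; split=> [i|].
    by rewrite -subr_le0; exact: bt.
  by rewrite -subr_gt0.
exists l; split=> //.
  (* Testing on the constant affine functional shows that the weights sum to 1;
     testing on the coordinate functionals identifies w. *)
  have := lE (0, 1); rewrite /F /coord_scalar mulmx0 mxE sub0r => /eqP.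
  under eq_bigr => i _ do rewrite mulmx0 mxE sub0r mulrN1.
  by rewrite sumrN eqr_opp => /eqP.
apply: c_inj; apply/rowP => j; have := lE (delta_mx j 0, 0).
have E x : F x (delta_mx j 0, 0) = c x 0 j.
  by rewrite /F /coord_scalar subr0 -colE mxE.
rewrite E => ->; rewrite linear_sum summxE; apply: eq_bigr => i _.
by rewrite E linearZ mxE.
Qed.

Lemma hull_pt m (p : 'I_m -> V) i : hull p (p i).
Proof.
exists (fun j => (i == j)%:R); split=> [j||]; first by case: eqP.
  by rewrite (bigD1 i) //= eqxx big1 ?addr0 // => j /negPf; rewrite eq_sym => ->.
rewrite (bigD1 i) //= eqxx scale1r big1 ?addr0 // => j /negPf.
by rewrite eq_sym => ->; rewrite scale0r.
Qed.

Lemma hull_le m (p : 'I_m -> V) (f : {scalar V}) t x :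
  (forall i, f (p i) <= t) -> hull p x -> f x <= t.
Proof.
move=> H [a [a0 a1 ->]]; rewrite linear_sum /= -[t]mul1r -a1 mulr_suml.
by apply: ler_sum => i _; rewrite linearZ ler_wpM2l.
Qed.

Lemma hull_subset m (p : 'I_m -> V) n (q : 'I_n -> V) :
  (forall i, hull p (q i)) -> hull q `<=` hull p.
Proof.
move=> /choice[b /all_and3[b0 b1 bE]] x [a [a0 a1 ->]].
exists (fun j => \sum_i a i * b i j); split.
- by move=> j; apply: sumr_ge0 => i _; rewrite mulr_ge0.
- rewrite exchange_big -[RHS]a1; apply: eq_bigr => i _.
  by rewrite -mulr_sumr b1 mulr1.
under [RHS]eq_bigr => j _ do rewrite scaler_suml.
rewrite exchange_big; apply: eq_bigr => i _.
by rewrite bE scaler_sumr; apply: eq_bigr => j _; rewrite scalerA.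
Qed.

(** If p k lies strictly between two other points of the hull, its own weight
in the resulting convex combination is less than 1, so p k can be expressed by
the remaining points. *)
Lemma hull_drop m (p : 'I_m.+1 -> V) (k : 'I_m.+1) :
  ~ vertex (hull p) (p k) -> hull p = hull (fun i => p (lift k i)).
Proof.
move=> nv; rewrite eqEsubset; split; last first.
  by apply: hull_subset => i; exact: hull_pt.
have pk (c : 'I_m.+1 -> R) : (forall i, 0 <= c i) -> \sum_i c i = 1 ->
    p k = \sum_i c i *: p i -> c k != 1 -> hull (fun i => p (lift k i)) (p k).
  move=> c0 c1 cE ck.
  have ck1 : 1 - c k != 0 by rewrite subr_eq0 eq_sym.
  have S1 : \sum_i c (lift k i) = 1 - c k.
    by apply/eqP; rewrite eq_sym subr_eq addrC -c1 (bigD1_ord k).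
  have ck0 : 0 < 1 - c k by rewrite lt_def ck1 -S1; apply: sumr_ge0.
  exists (fun i => (1 - c k)^-1 * c (lift k i)); split.
  - by move=> i; rewrite mulr_ge0 // invr_ge0 ltW.
  - by rewrite -mulr_sumr S1 mulVf.
  under eq_bigr => i _ do rewrite -scalerA.
  rewrite -scaler_sumr; apply: (scalerI ck1); rewrite scalerA divff // scale1r.
  rewrite scalerBl scale1r; apply/eqP; rewrite subr_eq addrC.
  by rewrite {1}cE (bigD1_ord k).
apply: hull_subset => i; case: (unliftP k i) => [j ->|->].
  exact: (hull_pt (fun i => p (lift k i))).
move: nv; rewrite /vertex => /not_andP[/(_ (hull_pt p k))//|].
move=> /existsNP[x /existsNP[y /existsNP[t]]].
move=> /not_implyP[[a [a0 a1 aE]] /not_implyP[[b [b0 b1 bE]]]].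
move=> /not_implyP[/andP[t0 t1] /not_implyP[E nxy]].
have [|ck] := eqVneq (t * a k + (1 - t) * b k) 1; last first.
  apply: (@pk (fun i => t * a i + (1 - t) * b i)).
  - by move=> l; rewrite addr_ge0 // mulr_ge0 // ?subr_ge0 ltW.
  - by rewrite big_split /= -!mulr_sumr a1 b1; ring.
  - rewrite E aE bE !scaler_sumr -big_split; apply: eq_bigr => l _.
    by rewrite /= [RHS]scalerDl -!scalerA.
  - exact: ck.
have concl (c : 'I_m.+1 -> R) z : (forall i, 0 <= c i) -> \sum_i c i = 1 ->
    z = \sum_i c i *: p i -> c k = 1 -> z = p k.
  move=> c0 + + ck; rewrite !(bigD1_ord k) //= ck => /(canRL (addKr _)).
  rewrite addNr => /eqP; rewrite psumr_eq0 // => /allP cl ->.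
  rewrite scale1r big1 ?addr0 // => l _.
  by have /eqP -> := cl l (mem_index_enum _); rewrite scale0r.
have le1 (c : 'I_m.+1 -> R) : (forall i, 0 <= c i) -> \sum_i c i = 1 -> c k <= 1.
  by move=> c0 <-; rewrite (bigD1 k) //= lerDl sumr_ge0.
have ak := le1 a a0 a1; have bk := le1 b b0 b1 => cE.
exfalso; apply: nxy; split; [apply: (concl a)|apply: (concl b)] => //; nra.
Qed.

Lemma hull_vertices m (p : 'I_m -> V) :
  exists n (q : 'I_n -> V), hull p = hull q /\ forall i, vertex (hull p) (q i).
Proof.
elim: m p => [|m IH] p; first by exists 0%N, p; split=> // -[].
have [H|/existsNP[k nv]] := pselect (forall k, vertex (hull p) (p k)).
  by exists m.+1, p.
by rewrite (hull_drop nv); exact: IH.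
Qed.

End Convex.

Section Facets.
Context (R : realType) (V : lmodType R).

(** From an interior point u one can move by a small nonzero multiple of any
w; w is then a multiple of the difference of two points of the hull. *)
Lemma interior_spans m (p : 'I_m -> V) : nonempty_interior (hull p) -> spans p.
Proof.
move=> [U [Uo [u Uu] UP]] w.
(* Openness is tested by linear maps only, so the affine line u + t w is taken
   as the image of the points (1, t) of the plane. *)
pose f (x : 'rV[R]_2) : V := x 0 0 *: u + x 0 1 *: w.
have flin : linear f.
  by move=> a x y; rewrite /f !mxE !scalerDl -!scalerA addrACA scalerDr.
pose F : {linear 'rV[R]_2 -> V} :=
  HB.pack f (GRing.isLinear.Build R 'rV[R]_2 V _ f flin).
pose row t : 'rV[R]_2 := \row_j (if j == 0 then 1 else t).
have fE t : f (row t) = u + t *: w by rewrite /f !mxE /= scale1r.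
have : nbhs (row 0) (f @^-1` U).
  by apply: (open_nbhs_nbhs (conj (Uo _ F) _)); rewrite /= fE scale0r addr0.
move=> [B Brow BU].
have /nbhs_ballP[e /= e0 eB] : nbhs (0 : R) (B 0 1).
  by have := Brow 0 1; rewrite mxE.
have e2 : e / 2 != 0 by rewrite gt_eqF // divr_gt0.
have : U (u + (e / 2) *: w).
  rewrite -fE; apply: BU => i j; rewrite (ord1 i) mxE.
  have [->|j0] := eqVneq j 0.
    by have := nbhs_singleton (Brow 0 0); rewrite mxE eqxx.
  have -> : j = 1 by apply/val_inj; case: j j0 => -[|[|]].
  by apply: eB; rewrite /ball /= sub0r normrN ger0_norm; lra.
move=> /UP[b [_ _ bE]]; have [a [_ _ aE]] := UP _ Uu.
exists (fun i => (e / 2)^-1 * (b i - a i)).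
under eq_bigr => i _ do rewrite -scalerA scalerBl.
rewrite -scaler_sumr sumrB -bE -aE addrAC subrr add0r scalerA mulVf //.
by rewrite scale1r.
Qed.

Lemma sym_hull0 m (p : 'I_m -> V) :
  hull p !=set0 -> (forall x, hull p x -> hull p (- x)) -> hull p 0.
Proof.
move=> [x px] /(_ x px)[b [b0 b1 bE]]; have [a [a0 a1 aE]] := px.
exists (fun i => 2^-1 * (a i + b i)); split.
- by move=> i; rewrite mulr_ge0 ?addr_ge0 ?invr_ge0.
- by rewrite -mulr_sumr big_split /= a1 b1 mulVf.
under eq_bigr => i _ do rewrite -scalerA scalerDl.
by rewrite -scaler_sumr big_split /= -aE -bE subrr scaler0.
Qed.

(** f is moved in the direction g by the largest step that keeps it at most
1 on all points; the point k that limits the step becomes tight. The sign of g w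
keeps f w > 1. *)
Lemma tighten_functional m (p : 'I_m -> V) (f g : {scalar V}) w k0 :
  (forall i, f (p i) <= 1) -> 1 < f w ->
  (forall i, f (p i) = 1 -> g (p i) = 0) -> 0 <= g w -> 0 < g (p k0) ->
  exists f' : {scalar V},
    [/\ forall i, f' (p i) <= 1, 1 < f' w, forall i, f (p i) = 1 -> f' (p i) = 1
      & exists k, f' (p k) = 1 /\ f (p k) <> 1].
Proof.
move=> f1 fw fg gw gk0; pose t i := (1 - f (p i)) / g (p i).
have [k /= gk tk] := @arg_minP _ R _ k0 (fun i => 0 < g (p i)) t gk0.
have f'lin : scalar (fun x => f x + t k * g x).
  by move=> a x y; rewrite !linearP /=; ring.
have t0 : 0 <= t k by rewrite divr_ge0 ?subr_ge0 ?f1 ?(ltW gk).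
exists (scalar_of f'lin); split=> /= [i||i fi|].
- have [gi|gi] := ltP 0 (g (p i)).
    by have := tk i gi; rewrite [t i]/t ler_pdivlMr // lerBrDl.
  by rewrite -[1]addr0 lerD // mulr_ge0_le0.
- by rewrite ltr_wpDr // mulr_ge0.
- by rewrite fg // mulr0 addr0.
exists k; split; first by rewrite /t divfK ?gt_eqF // addrC subrK.
by move=> /fg gk1; rewrite gk1 ltxx in gk.
Qed.

(** Symmetry turns a functional that is nonpositive on all points into one
that vanishes on them. *)
Lemma sym_spanning_pos m (p : 'I_m -> V) (g : {scalar V}) x :
  spans p -> (forall x, hull p x -> hull p (- x)) -> g x != 0 ->
  exists k, 0 < g (p k).
Proof.
move=> sp sym; apply: contra_neqP => /forallNP H.
have gle i : g (p i) <= 0 by rewrite leNgt; apply/negP/H.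
have g0 i : g (p i) = 0.
  apply/eqP; rewrite eq_le gle /= -oppr_le0 -linearN.
  exact: hull_le gle (sym _ (hull_pt p i)).
have [a ->] := sp x; rewrite linear_sum big1 // => i _.
by rewrite linearZ g0 /= mulr0.
Qed.

(** Among the functionals separating w, one with the largest number of tight
points: if its tight points did not span, a nonzero functional vanishing on them
would allow [tighten_functional] to produce one more. *)
Lemma facet_separation m (p : 'I_m -> V) w :
  spans p -> hull p !=set0 -> (forall x, hull p x -> hull p (- x)) ->
  ~ hull p w ->
  exists f : {scalar V}, [/\ forall i, f (p i) <= 1, 1 < f w &
    forall x, exists a : 'I_m -> R,
      (forall i, f (p i) <> 1 -> a i = 0) /\ x = \sum_i a i *: p i].
Proof.
move=> sp p0 sym npw; have [d [c [c_inj c_surj]]] := spans_coord sp.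
(* Dividing by a number strictly between the threshold and the value at w
   normalizes the threshold to 1; it is positive because 0 is in the hull. *)
have [f [f1 fw]] : exists f : {scalar V}, (forall i, f (p i) <= 1) /\ 1 < f w.
  have [f [t [ft tw]]] := hull_separation c_inj npw.
  have t0 : 0 <= t by rewrite -(linear0 f); exact: hull_le ft (sym_hull0 p0 sym).
  pose s := (t + f w) / 2; have s0 : 0 < s by rewrite /s; lra.
  have glin : scalar (fun x => f x / s) by move=> a x y; rewrite linearP /=; ring.
  exists (scalar_of glin); split=> /= [i|].
    by rewrite ler_pdivrMr // mul1r; have := ft i; rewrite /s; lra.
  by rewrite ltr_pdivlMr // mul1r /s; lra.
pose T (f : {scalar V}) := [set i : 'I_m | f (p i) == 1]%SET.
have [k] := ubnP (m - #|T f|); elim: k f f1 fw => // k IH f f1 fw fk.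
(* The rows of A are the coordinates of the tight points; the tight points
   span exactly when A has full row space, and a column of its cokernel is a
   functional vanishing on them. *)
pose A : 'M[R]_(m, d) := \matrix_i (if f (p i) == 1 then c (p i) else 0).
have [Afull|Afull] := boolP (row_full A).
  exists f; split=> // x; have /submxP[D DE] := submx_full (c x) Afull.
  exists (fun i => if f (p i) == 1 then D 0 i else 0); split.
    by move=> i /eqP/negPf ->.
  apply: c_inj; rewrite DE linear_sum mulmx_sum_row; apply: eq_bigr => i _.
  by rewrite rowK linearZ /=; case: eqP => // _; rewrite scaler0 scale0r.
have [i [j Kij]] : exists i j, cokermx A i j != 0.
  move: Afull; rewrite -cokermx_eq0; apply: contra_neqP => H.
  apply/matrixP => i j; rewrite [RHS]mxE; apply: contra_notP H => /eqP Kij.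
  by exists i, j.
pose g0 := scalar_of (coord_scalar_linear c (col j (cokermx A))).
have g0p l : f (p l) = 1 -> g0 (p l) = 0.
  move=> fl; rewrite /= /coord_scalar.
  have -> : c (p l) = row l A by rewrite rowK fl eqxx.
  by rewrite rowE colE -mulmxA (mulmxA A) mulmx_coker mul0mx mulmx0 mxE.
have [x g0x] : exists x, g0 x != 0.
  have [x cx] := c_surj (delta_mx 0 i); exists x.
  by rewrite /= /coord_scalar cx -rowE 2!mxE.
have [g [gp gw [k0 gk0]]] : exists g : {scalar V},
    [/\ forall l, f (p l) = 1 -> g (p l) = 0, 0 <= g w & exists k, 0 < g (p k)].
  (* The sign of g0 is chosen so that moving along it does not decrease f w. *)
have [gw|gw] := leP 0 (g0 w).
    by exists g0; split=> //; exact: sym_spanning_pos g0x.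
  have Nlin : scalar (fun x => - g0 x) by move=> a y z; rewrite linearP /=; ring.
  exists (scalar_of Nlin); split=> /= [l /g0p/= ->||]; rewrite ?oppr0 ?oppr_ge0 ?ltW //.
  apply: (@sym_spanning_pos _ _ (scalar_of Nlin) x) => //=.
  by rewrite oppr_eq0.
have [f' [f'1 f'w f'f [l [f'l fl]]]] := tighten_functional f1 fw gp gw gk0.
apply: (IH f') => //; apply: leq_trans (_ : (m - #|T f| <= k)%N) => //.
apply: ltn_sub2l.
  rewrite -[X in (_ < X)%N](card_ord m) -cardsT; apply: proper_card.
  by rewrite properE finset.subsetT; apply/fintype.subsetPn; exists l; rewrite inE //; apply/eqP.
apply: proper_card; apply/fintype.properP; split.
  by apply/fintype.subsetP => y; rewrite !inE => /eqP/f'f ->.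
by exists l; rewrite inE; apply/eqP.
Qed.

Lemma polytope_vertices (P : set V) : polytope P ->
  exists m (p : 'I_m -> V), P = hull p /\ forall i, vertex P (p i).
Proof.
move=> [n [q PE]]; have [m [p [pE vp]]] := hull_vertices q.
by exists m, p; rewrite PE -/(hull q); split.
Qed.

(** The uniqueness clause is what identifies the functional f with a facet
functional that is known on the vertices of the facet only. *)
Lemma polytope_facet (P : set V) w : polytope P -> nonempty_interior P ->
  (forall x, P x -> P (- x)) -> ~ P w ->
  exists f : {scalar V}, [/\ facet P [set x | P x /\ f x = 1], 1 < f w &
    forall h : {scalar V}, (forall v, vertex P v -> f v = 1 -> h v = 1) ->
      forall x, h x = f x].
Proof.
move=> PP int sym npw.
have [m [p [PE vp]]] := polytope_vertices PP.
have P0 : P !=set0 by have [U [_ [u Uu] UP]] := int; exists u; exact: UP.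
have sp : spans p by apply: interior_spans; rewrite -PE.
have [f [f1 fw fsp]] : exists f : {scalar V}, [/\ forall i, f (p i) <= 1, 1 < f w &
    forall x, exists a : 'I_m -> R,
      (forall i, f (p i) <> 1 -> a i = 0) /\ x = \sum_i a i *: p i].
  by apply: facet_separation => //; rewrite -PE.
exists f; split=> //; last first.
  move=> h hf x; have [a [a0 ->]] := fsp x; rewrite !linear_sum.
  apply: eq_bigr => i _; rewrite !linearZ /=.
  have [fi|/a0 ->] := pselect (f (p i) = 1); last by rewrite !mul0r.
  by rewrite fi (hf (p i)).
have [k fk] : exists k, f (p k) = 1.
  apply: contrapT => /forallNP H; have [a [a0 aE]] := fsp w.
  move: fw; rewrite aE big1 => [|i _]; last by rewrite (a0 i (H i)) scale0r.
  by rewrite linear0 ltr10.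
have Pp i : P (p i) by rewrite PE; exact: hull_pt.
split; first split; first by exists (p k).
  by exists f, 1; split=> // x; rewrite PE; exact: hull_le.
exists (p k); split.
  move=> [l [a [x [y [xy /(congr1 f)]]]]].
  rewrite fk linear_sum big1 => [/eqP|i _]; first by rewrite oner_eq0.
  by have [[_ fx] [_ fy]] := xy i; rewrite linearZ /= linearB /= fx fy subrr mulr0.
move=> x; have [a [a0 ->]] := fsp x; exists (\sum_i a i).
exists m, a, (fun i => if f (p i) == 1 then p i else p k), (fun=> p k); split.
  by move=> i; case: eqP.
rewrite scaler_suml -sumrB; apply: eq_bigr => i _; rewrite scalerBr.
by case: eqP => // /a0 ->; rewrite !scale0r.
Qed.

Lemma subadditive_sum (N : V -> R) m (x : 'I_m -> V) :
  N 0 = 0 -> (forall v w, N (v + w) <= N v + N w) ->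
  N (\sum_i x i) <= \sum_i N (x i).
Proof.
move=> N0 ND; elim: m x => [|m IH] x; first by rewrite !big_ord0 N0.
by rewrite !big_ord_recl (le_trans (ND _ _)) // lerD2l.
Qed.

(** For a natural number D, rounding the coefficients of D w to integers changes
both f and N by at most a constant C that does not depend on D; divide by D. *)
Lemma scalar_le_of_int_comb m (u : 'I_m -> V) (f : {scalar V}) (N : V -> R) :
  (forall v w, N (v + w) <= N v + N w) ->
  (forall a v, N (a *: v) = `|a| * N v) ->
  spans u ->
  (forall k : 'I_m -> int, let v := \sum_i (k i)%:~R *: u i in f v <= N v) ->
  forall w, f w <= N w.
Proof.
move=> ND NZ sp fN w; have [a aE] := sp w.
have N0 : N 0 = 0 by rewrite -(scale0r (0 : V)) NZ normr0 mul0r.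
have Nge0 v : 0 <= N v.
  have := ND v (- v); rewrite subrr N0 -scaleN1r NZ normrN normr1 mul1r.
  by rewrite -mulr2n pmulrn_lge0.
pose C := \sum_i (`|f (u i)| + N (u i)).
have C0 : 0 <= C by apply: sumr_ge0 => i _; rewrite addr_ge0.
have bound (D : nat) : D%:R * (f w - N w) <= C.
  pose k i := Num.floor (D%:R * a i); pose r i := D%:R * a i - (k i)%:~R.
  have r1 i : `|r i| <= 1.
    have /andP[] := floor_itv (D%:R * a i).
    by rewrite intrD -/(k i) => h1 h2; rewrite /r ger0_norm; lra.
  pose v := \sum_i (k i)%:~R *: u i; pose z := \sum_i r i *: u i.
  have DE : D%:R *: w = v + z.
    rewrite aE scaler_sumr -big_split /=; apply: eq_bigr => i _.
    by rewrite scalerA -scalerDl addrC subrK.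
  have fz : f z <= \sum_i `|f (u i)|.
    rewrite linear_sum; apply: ler_sum => i _; rewrite linearZ /=.
    by rewrite (le_trans (ler_norm _)) // normrM ler_piMl.
  have Nz : N (- z) <= \sum_i N (u i).
    rewrite -scaleN1r NZ normrN normr1 mul1r (le_trans (subadditive_sum _ N0 ND)) //.
    by apply: ler_sum => i _; rewrite NZ ler_piMl.
  have Nv : N v <= D%:R * N w + N (- z).
    by rewrite -[X in X * N w]ger0_norm // -NZ DE (le_trans _ (ND _ _)) // addrK.
  have := fN k; rewrite /= -/v => fv.
  have := congr1 f DE; rewrite linearD linearZ /= => DfE.
  rewrite mulrBr DfE /C big_split /=; lra.
rewrite leNgt; apply/negP => fw.
have {}fw : 0 < f w - N w by rewrite subr_gt0.
have := bound (Num.bound (C / (f w - N w))).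
rewrite leNgt => /negP; apply.
by rewrite -ltr_pdivrMr //; apply: archi_boundP; rewrite divr_ge0 // ltW.
Qed.

End Facets.

(** * Integrals of bounded functions *)

Section Integral.
Context d (T : measurableType d) (R : realType) (mu : {measure set T -> \bar R}).

(** The integral of a nonnegative function is a supremum over the simple
functions below it, and a larger function has more of these. *)
Lemma ge0_subset_le_integral (D : set T) (f g : T -> \bar R) :
  (forall x, D x -> 0 <= f x <= g x)%E ->
  (\int[mu]_(x in D) f x <= \int[mu]_(x in D) g x)%E.
Proof.
move=> fg; rewrite !ge0_integralE => [||x Dx]; first last.
- by have /andP[] := fg x Dx.
- by move=> x Dx; have /andP[f0] := fg x Dx; exact: le_trans.
apply: ereal_sup_le => _ [h hf <-]; exists h => // x.
apply: le_trans (hf x) _; rewrite !patchE.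
by case: ifPn => //; rewrite inE => /fg/andP[].
Qed.

(** The bound B keeps the integrals finite, so that their real values compare.
This form suits integrands along a piecewise smooth curve, whose velocity is read
in charts that jump from point to point: they are bounded by continuity in fixed
charts. *)
Lemma le_Rintegral_bounded (D : set T) (f s : T -> R) (B : R) :
  measurable D -> (mu D < +oo)%E ->
  (forall x, D x -> `|f x| <= s x <= B) ->
  \int[mu]_(x in D) f x <= \int[mu]_(x in D) s x.
Proof.
move=> mD Dfin fs.
have s_fin : (\int[mu]_(x in D) (s x)%:E)%E \is a fin_num.
  rewrite ge0_fin_numE; last first.
    by apply: integral_ge0 => x /fs/andP[f0 _]; rewrite lee_fin (le_trans _ f0).
  apply: (@le_lt_trans _ _ (\int[mu]_(x in D) `|B|%:E)%E).
    apply: ge0_subset_le_integral => x /fs/andP[f0 sB].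
    by rewrite !lee_fin (le_trans sB (ler_norm B)) (le_trans _ f0).
  by rewrite integral_cst // lte_mul_pinfty.
have f_le (h : T -> \bar R) : (forall x, D x -> 0 <= h x <= (s x)%:E)%E ->
    (0 <= \int[mu]_(x in D) h x <= \int[mu]_(x in D) (s x)%:E)%E.
  move=> hs; rewrite ge0_subset_le_integral // integral_ge0 // => x Dx.
  by have /andP[] := hs x Dx.
have f_fin (h : T -> \bar R) : (forall x, D x -> 0 <= h x <= (s x)%:E)%E ->
    (\int[mu]_(x in D) h x)%E \is a fin_num.
  by move=> /f_le/andP[h0 hs]; rewrite ge0_fin_numE // (le_lt_trans hs) // ltey_eq s_fin.
have pos x : D x -> (0 <= (EFin \o f)^\+%E x <= (s x)%:E)%E.
  move=> /fs/andP[fs' _]; rewrite funepos_ge0 funeposE ge_max !lee_fin.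
  by rewrite (le_trans (ler_norm _) fs') (le_trans _ fs').
have neg x : D x -> (0 <= (EFin \o f)^\-%E x <= (s x)%:E)%E.
  move=> /fs/andP[fs' _]; rewrite funeneg_ge0 funenegE ge_max.
  rewrite -[(- _)%E]/((- f x)%:E) !lee_fin.
  by rewrite (le_trans _ fs') ?(le_trans (normr_ge0 _) fs') // -normrN ler_norm.
rewrite /Rintegral integralE fineB ?f_fin // lerBlDr.
rewrite (@le_trans _ _ (fine (\int[mu]_(x in D) (s x)%:E)%E)) //.
  by have /andP[_ ps] := f_le _ pos; apply: fine_le => //; exact: f_fin.
by have /andP[n0 _] := f_le _ neg; rewrite lerDl fine_ge0.
Qed.

End Integral.

(** * Metrics on tangent and cotangent spaces *)

Section Algebra.
Context (R : realType) (n : nat) (M : topologicalType) (X : manifold R n M).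
Variables (g : metric R n M) (g_riem : riemannian X g).

Lemma innerDl x u v w : inner g x (u + v) w = inner g x u w + inner g x v w.
Proof. by rewrite /inner !mulmxDl mxE. Qed.

Lemma innerZl x a u w : inner g x (a *: u) w = a * inner g x u w.
Proof. by rewrite /inner -!scalemxAl mxE. Qed.

Lemma innerC x u v : inner g x u v = inner g x v u.
Proof.
rewrite /inner -[u *m _ *m _]trmxK [LHS]mxE !trmx_mul trmxK (riem_sym g_riem).
by rewrite mulmxA.
Qed.

Lemma inner_ge0 x u : 0 <= inner g x u u.
Proof.
have [->|u0] := eqVneq u 0; first by rewrite /inner !mul0mx mxE.
by rewrite ltW // (riem_pos g_riem).
Qed.

Lemma metric_unit x : g x \in unitmx.
Proof.
rewrite -row_free_unit -kermx_eq0; apply/eqP/row_matrixP => i; rewrite row0.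
apply/eqP; have [//|/(riem_pos g_riem x)] := eqVneq (row i (kermx (g x))) 0.
by rewrite /inner -row_mul mulmx_ker row0 mul0mx mxE ltxx.
Qed.

(** The vector dual to the covector a. *)
Definition sharp x (a : 'cV[R]_n) : 'rV[R]_n := (invmx (g x) *m a)^T.

Lemma pairing_sharp x v a : pairing v a = inner g x v (sharp x a).
Proof. by rewrite /pairing /inner trmxK -mulmxA mulKVmx // metric_unit. Qed.

Lemma dual_norm2_sharp x a : dual_norm2 g x a = inner g x (sharp x a) (sharp x a).
Proof.
rewrite /dual_norm2 /inner trmxK /sharp -[(_ *m a)^T *m _ *m _]mulmxA.
rewrite mulKVmx ?metric_unit // trmx_mul trmx_inv (riem_sym g_riem) //.
Qed.

Lemma dual_norm2Z x c a : dual_norm2 g x (c *: a) = c ^+ 2 * dual_norm2 g x a.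
Proof.
have tZ : (c *: a)^T = c *: a^T by rewrite linearZ.
by rewrite /dual_norm2 tZ -!scalemxAl -scalemxAr scalerA mxE expr2.
Qed.

Lemma cauchy_schwarz x u v :
  inner g x u v ^+ 2 <= inner g x u u * inner g x v v.
Proof.
have [->|v0] := eqVneq v 0.
  by rewrite innerC -(scale0r (0 : 'rV[R]_n)) !innerZl !mul0r expr0n /= mulr0.
have vv : 0 < inner g x v v by exact: (riem_pos g_riem).
(* The squared norm of the component of u orthogonal to v, scaled by v.v. *)
have := inner_ge0 x (u - (inner g x u v / inner g x v v) *: v).
rewrite -scaleNr innerDl innerZl innerC [X in _ + _ * X]innerC !innerDl !innerZl.
rewrite (innerC x v u) => H; rewrite -subr_ge0.
suff -> : inner g x u u * inner g x v v - inner g x u v ^+ 2 =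
   inner g x v v * (inner g x u u + - (inner g x u v / inner g x v v) * inner g x u v +
   - (inner g x u v / inner g x v v) * (inner g x u v +
   - (inner g x u v / inner g x v v) * inner g x v v)).
  by rewrite mulr_ge0 // ltW.
by field; rewrite gt_eqF.
Qed.

Lemma pairing_le x v a : dual_norm2 g x a <= 1 ->
  `|pairing v a| <= Num.sqrt (inner g x v v).
Proof.
rewrite dual_norm2_sharp (pairing_sharp x) => a1.
rewrite -[leLHS]sqrtr_sqr ler_wsqrtr //.
by rewrite (le_trans (cauchy_schwarz _ _ _)) // ler_piMr // inner_ge0.
Qed.

(** Such a covector is a multiple of the dual of u, and equality holds in the
Cauchy-Schwarz inequality for the pair. *)
Lemma dual_norm2_normalized x u a : u != 0 -> pairing u a = 1 ->
  (forall v, inner g x v u = 0 -> pairing v a = 0) ->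
  dual_norm2 g x a = (inner g x u u)^-1.
Proof.
move=> u0 ua va; have uu : inner g x u u != 0 by rewrite gt_eqF // (riem_pos g_riem).
pose t := (inner g x u u)^-1.
suff aE : sharp x a = t *: u.
  by rewrite dual_norm2_sharp aE innerZl innerC innerZl mulrA -expr2 /t expr2 mulfVK.
apply/eqP; rewrite -subr_eq0; apply: contraT => /(riem_pos g_riem x).
(* w is orthogonal to u, hence killed by a, hence orthogonal to itself. *)
set w := _ - _; have wu : inner g x w u = 0.
  rewrite /w -scaleNr innerDl innerZl innerC -pairing_sharp ua /t mulNr mulVf //.
  by rewrite subrr.
have := va w wu; rewrite (pairing_sharp x) => wa.
rewrite {2}/w innerC innerDl -scaleNr innerZl innerC wa (innerC x u) wu.
by rewrite mulr0 addr0 ltxx.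
Qed.

End Algebra.

(** * Curves in charts *)

Section SmoothOn.
Context (R : realType) (V W : normedModType R) (A : set V) (f : V -> W).
Hypothesis f_smooth : smooth_on A f.

Lemma smooth_on_differentiable x : A x -> differentiable f x.
Proof. by have [df _] := f_smooth 1; exact: df. Qed.

Lemma smooth_on_derive_cts v x : A x -> {for x, continuous ('D_v f)}.
Proof. by have [_ /(_ v)] := f_smooth 1; apply. Qed.

End SmoothOn.

Lemma near_eq_continuous_for (T U : topologicalType) (f g : T -> U) x :
  (\forall y \near x, f y = g y) -> {for x, continuous g} -> {for x, continuous f}.
Proof.
move=> fg gx; rewrite /prop_for /continuous_at (nbhs_singleton fg).
by apply: cvg_trans gx; apply: near_eq_cvg; apply: filterS fg.
Qed.

Section Curves.
Context (R : realType) (n : nat) (M : topologicalType) (X : manifold R n M).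
Variables (O : set R) (sigma : R -> M) (t : R).
Hypotheses (O_open : open O) (sigma_smooth : smooth_into X O sigma) (Ot : O t).

Lemma near_smooth_dom (A : set M) : open A -> A (sigma t) ->
  \forall s \near t, O s /\ A (sigma s).
Proof.
move=> Ao At; near=> s; split; near: s; first exact: open_nbhs_nbhs.
by apply: (sigma_smooth.1 _ Ot); exact: open_nbhs_nbhs.
Unshelve. all: by end_near. Qed.

Section Chart.
Variable c : chart R n M.
Hypotheses (Xc : charts X c) (ct : cdom c (sigma t)).

Lemma coord_curve_differentiable : differentiable (coord c \o sigma) t.
Proof. by apply: (smooth_on_differentiable (sigma_smooth.2 _ Xc)). Qed.

(** The velocity is defined in the chart chosen at sigma t, which varies with
t; this expresses it in one fixed chart. *)
Lemma velocity_chart :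
  velocity X sigma t =
  dicoord X c (coord c (sigma t)) ('D_1 (coord c \o sigma) t).
Proof.
rewrite /velocity /dicoord coordK //; set c' := chart_at X (sigma t).
have [Xc' c't] : charts X c' /\ cdom c' (sigma t) by exact: chart_atP.
rewrite derive1E; transitivity ('D_1 ((coord c' \o icoord c) \o (coord c \o sigma)) t).
  apply: near_eq_derive; near=> s; rewrite /= coordK //.
  by near: s; apply: filterS (near_smooth_dom (@cdom_open _ _ _ c) ct) => s [].
have d1 := coord_curve_differentiable.
have d2 : differentiable (coord c' \o icoord c) ((coord c \o sigma) t).
  by apply: (smooth_on_differentiable (transition Xc Xc')); exists (sigma t).
rewrite deriveE; last exact: differentiable_comp.
by rewrite diff_comp //= deriveE.
Unshelve. all: by end_near. Qed.

End Chart.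

Lemma dicoordE c p (u : 'rV[R]_n) :
  dicoord X c p u = u *m (\matrix_i dicoord X c p (base R i)).
Proof.
rewrite mulmx_sum_row {1}(row_sum_delta u) /dicoord linear_sum.
by apply: eq_bigr => i _; rewrite linearZ rowK.
Qed.

(** In a fixed chart the squared speed is a continuous expression in t, in spite
of the varying charts in the definition of the velocity. *)
Lemma inner_velocity_chart (g : metric R n M) c :
  charts X c -> cdom c (sigma t) ->
  let u := 'D_1 (coord c \o sigma) t in
  inner g (sigma t) (velocity X sigma t) (velocity X sigma t) =
  (u *m metric_coord X c g (coord c (sigma t)) *m u^T) 0 0.
Proof.
move=> Xc ct u; rewrite (velocity_chart Xc ct) dicoordE /inner trmx_mul.
set D := \matrix_i _.
have -> : metric_coord X c g (coord c (sigma t)) = D *m g (sigma t) *m D^T.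
  have rD k : dicoord X c (coord c (sigma t)) (base R k) = row k D by rewrite rowK.
  apply/matrixP => i j; rewrite mxE /inner coordK // !rD -row_mul [LHS]mxE [RHS]mxE.
  by apply: eq_bigr => k _; rewrite !mxE.
by rewrite !mulmxA.
Qed.

Lemma differential_curve (U : set M) (f : M -> R) :
  open U -> smooth_fun X U f -> U (sigma t) ->
  differentiable (f \o sigma) t /\
  pairing (velocity X sigma t) (differential X f (sigma t)) = 'D_1 (f \o sigma) t.
Proof.
move=> Uo f_smooth Ut; set c := chart_at X (sigma t).
have [Xc ct] : charts X c /\ cdom c (sigma t) by exact: chart_atP.
have feq : {near t, (f \o icoord c) \o (coord c \o sigma) =1 f \o sigma}.
  near=> s; rewrite /= coordK //.
  by near: s; apply: filterS (near_smooth_dom (@cdom_open _ _ _ c) ct) => s [].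
have d1 : differentiable (coord c \o sigma) t by exact: coord_curve_differentiable.
have d2 : differentiable (f \o icoord c) ((coord c \o sigma) t).
  by apply: (smooth_on_differentiable (f_smooth _ Xc)); exists (sigma t).
have d := differentiable_comp d1 d2; split.
  apply/derivable1_diffP; apply: near_eq_derivable feq _.
  exact/derivable1_diffP.
rewrite -(near_eq_derive _ feq) deriveE // diff_comp //= /velocity derive1E -/c.
rewrite -(deriveE _ d1); set u := 'D_1 _ t.
rewrite [in RHS](row_sum_delta u) linear_sum /pairing mxE.
by apply: eq_bigr => i _; rewrite linearZ /= mxE deriveE.
Unshelve. all: by end_near. Qed.

End Curves.

(** * Lengths of piecewise smooth curves *)

Lemma continuous_quadratic (R : realType) (T : topologicalType) n
    (u : T -> 'rV[R]_n) (A : T -> 'M[R]_n) x :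
  {for x, continuous u} -> {for x, continuous A} ->
  {for x, continuous (fun y => (u y *m A y *m (u y)^T) 0 0)}.
Proof.
move=> uc Ac.
have -> : (fun y => (u y *m A y *m (u y)^T) 0 0) =
    (fun y => \sum_j (\sum_i u y 0 i * A y i j) * u y 0 j).
  by apply/funext => y; rewrite mxE; apply: eq_bigr => j _; rewrite !mxE.
have uic i : u y 0 i @[y --> x] --> u x 0 i.
  exact: (continuous_comp uc (@coord_continuous _ _ _ _ _ _)).
apply: (@cvg_big R^o) => [|j _]; first exact: add_continuous.
apply: cvgM => //; apply: (@cvg_big R^o) => [|i _]; first exact: add_continuous.
apply: cvgM => //.
exact: (continuous_comp Ac (@coord_continuous _ _ _ _ _ _)).
Qed.

Section Speed.
Context (R : realType) (n : nat) (M : topologicalType) (X : manifold R n M).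
Variables (g : metric R n M) (g_riem : riemannian X g).

Lemma speed_continuous (O : set R) (sigma : R -> M) t :
  open O -> smooth_into X O sigma -> O t ->
  {for t, continuous (speed X g sigma)}.
Proof.
move=> Oo ss Ot; set c := chart_at X (sigma t).
have [Xc ct] : charts X c /\ cdom c (sigma t) by exact: chart_atP.
pose u s := 'D_1 (coord c \o sigma) s.
pose A s := metric_coord X c g (coord c (sigma s)).
apply: (@near_eq_continuous_for _ _ _
  (fun s => Num.sqrt ((u s *m A s *m (u s)^T) 0 0))).
  near=> s; rewrite /speed (inner_velocity_chart Oo ss _ g Xc) //.
  - by near: s; apply: filterS (near_smooth_dom Oo ss Ot (@cdom_open _ _ _ c) ct) => s [].
  - by near: s; apply: filterS (near_smooth_dom Oo ss Ot (@cdom_open _ _ _ c) ct) => s [].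
apply: continuous_comp; last exact: sqrt_continuous.
apply: continuous_quadratic.
  by apply: (smooth_on_derive_cts (ss.2 _ Xc)).
apply: (@continuous_comp _ _ _ (coord c \o sigma) (metric_coord X c g)).
  exact/differentiable_continuous/(coord_curve_differentiable ss Ot Xc ct).
by apply: (riem_smooth g_riem Xc 0%N); exists (sigma t).
Unshelve. all: by end_near. Qed.

Lemma near_eq_speed (gamma sigma : R -> M) t :
  (\forall s \near t, gamma s = sigma s) -> speed X g gamma t = speed X g sigma t.
Proof.
move=> E; have Et := nbhs_singleton E.
suff V : velocity X gamma t = velocity X sigma t by rewrite /speed V Et.
rewrite /velocity Et !derive1E; apply: near_eq_derive.
by apply: filterS E => s /= ->.
Qed.

(** On each closed piece the curve agrees with a smooth curve defined on a
neighbourhood, whose speed is continuous. At a break point the velocity may be the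
default value of a missing derivative, but there are finitely many of them. *)
Lemma speed_bounded (gamma : R -> M) : piecewise_smooth X gamma ->
  exists B, forall t, 0 <= t <= 1 -> speed X g gamma t <= B.
Proof.
move=> [m [a [a0 am apiece]]].
suff H k : (k <= m)%N ->
    exists B, forall t, a 0%N <= t <= a k -> speed X g gamma t <= B.
  by have := H m (leqnn m); rewrite a0 am.
elim: k => [_|k IH km].
  by exists (speed X g gamma (a 0%N)) => t /le_anti <-.
have [B1 B1P] := IH (ltnW km).
have [ak [A [sigma [Ao aA ss E]]]] := apiece k km.
have [d _ dP] : exists2 d, d \in `[a k, a k.+1]%R &
    forall t, t \in `[a k, a k.+1]%R -> speed X g sigma t <= speed X g sigma d.
  apply: EVT_max (ltW ak) _; apply: continuous_in_subspaceT => t.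
  by rewrite inE => /aA; exact: speed_continuous.
exists (Num.max B1 (Num.max (speed X g sigma d) (speed X g gamma (a k.+1)))) => t.
move=> /andP[t0 tk]; rewrite !le_max.
have [tk1|tk1] := leP t (a k); first by rewrite B1P ?t0.
have [tk2|tk2] := ltP t (a k.+1); last first.
  by rewrite (@le_anti _ _ t (a k.+1)) ?tk ?tk2 // lexx !orbT.
rewrite (@near_eq_speed gamma sigma); last first.
  have : t \in `]a k, a k.+1[ by rewrite in_itv /= tk1.
  move=> /near_in_itvoo; apply: filterS => s /=.
  by rewrite in_itv /= => /andP[s1 s2]; apply: E; rewrite !ltW.
by rewrite dP ?orbT // in_itv /= !ltW.
Qed.

Lemma line_integral_le (w : M -> 'cV[R]_n) (gamma : R -> M) :
  piecewise_smooth X gamma -> (forall x, dual_norm2 g x (w x) <= 1) ->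
  line_integral X w gamma <= curve_length X g gamma.
Proof.
move=> /speed_bounded[B BP] w1.
apply: (@le_Rintegral_bounded _ _ _ _ _ _ _ B) => //.
  by rewrite /= lebesgue_measure_itv /= lte_fin ltr01 oppr0 adde0 ltry.
move=> t; rewrite /= in_itv /= => t01; rewrite BP // andbT.
by apply: (pairing_le g_riem).
Qed.

Lemma curve_length_ge0 gamma : 0 <= curve_length X g gamma.
Proof. by apply: Rintegral_ge0 => t _; exact: sqrtr_ge0. Qed.

End Speed.

(** * The core curves of the tubes *)

Lemma near_int_cst (R : realType) (k : R -> R) t :
  {for t, continuous k} -> (\forall s \near t, k s \is a Num.int) ->
  \forall s \near t, k s = k t.
Proof.
move=> kc kint; have kt := nbhs_singleton kint.
have kst : \forall s \near t, `|k t - k s| < 1.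
  by have /cvgr_dist_lt := (kc : k x @[x --> t] --> k t); apply.
near=> s; have ks : k s \is a Num.int by near: s.
have : `|k t - k s| < 1 by near: s.
have /intrP[z kE] : k t - k s \is a Num.int by rewrite rpredB.
rewrite kE -intr_norm (ltr_int _ _ 1) => z1.
have z0 : z = 0 by lia.
by apply/eqP; rewrite eq_sym -subr_eq0 kE z0.
Unshelve. all: by end_near. Qed.

Section Core.
Context (R : realType) (n : nat) (M : topologicalType) (X : manifold R n M).
Variables (rho : metric R n M) (gamma : R -> M) (r : R).
Hypotheses (n_gt1 : (1 < n)%N) (rho_riem : riemannian X rho).
Hypotheses (gamma_adm : admissible_curve X rho gamma) (r_gt0 : 0 < r).
Hypothesis gamma_tub : tubular X rho gamma r.

Lemma normal_vectorZ t v a :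
  inner rho (gamma t) v (velocity X gamma t) = 0 ->
  `|a| * Num.sqrt (inner rho (gamma t) v v) < r ->
  normal_vector X rho gamma r t (a *: v).
Proof.
move=> vn avr; split; first by rewrite innerZl vn mulr0.
rewrite innerZl (innerC rho_riem) innerZl mulrA -expr2.
by rewrite sqrtrM ?sqr_ge0 // sqrtr_sqr.
Qed.

Lemma normal_vector0 t : normal_vector X rho gamma r t 0.
Proof.
rewrite -(scale0r (0 : 'rV[R]_n)); apply: normal_vectorZ.
  by rewrite -(scale0r (0 : 'rV[R]_n)) innerZl mul0r.
by rewrite normr0 mul0r.
Qed.

Lemma exp_map_inj t v s w :
  normal_vector X rho gamma r t v -> normal_vector X rho gamma r s w ->
  exp_map X rho (gamma t, v) = exp_map X rho (gamma s, w) ->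
  gamma t = gamma s /\ v = w.
Proof.
move=> tv sw E; have [F [FK _]] := tub_inverse gamma_tub.
have Kt : F (exp_map X rho (gamma t, v)) = (gamma t, v) by apply: FK; exists t.
have Ks : F (exp_map X rho (gamma s, w)) = (gamma s, w) by apply: FK; exists s.
by move: Kt; rewrite E Ks => -[].
Qed.

Lemma foot_int t v s :
  normal_vector X rho gamma r t v ->
  foot X rho gamma r (exp_map X rho (gamma t, v)) s -> s - t \is a Num.int.
Proof.
move=> tv [w [sw /exp_map_inj[] // E _]].
by apply: (adm_simple gamma_adm).
Qed.

(** The normal space is the kernel of one linear form in dimension n > 1. *)
Lemma exists_normal t : exists v : 'rV[R]_n,
  v != 0 /\ normal_vector X rho gamma r t v.
Proof.
pose b := rho (gamma t) *m (velocity X gamma t)^T.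
have : kermx b != 0.
  rewrite -mxrank_eq0 mxrank_ker subn_eq0 -ltnNge.
  exact: leq_ltn_trans (rank_leq_col b) n_gt1.
have [H|/existsNP[i /eqP w0] _] := pselect (forall i, row i (kermx b) = 0).
  by case/eqP; apply/row_matrixP => i; rewrite H row0.
set w := row i _ in w0; have wn : inner rho (gamma t) w (velocity X gamma t) = 0.
  by rewrite /inner -mulmxA -row_mul mulmx_ker row0 mxE.
set L := Num.sqrt (inner rho (gamma t) w w); have L0 : 0 <= L by exact: sqrtr_ge0.
have L1 : 0 < L + 1 by rewrite ltr_wpDl.
have a0 : 0 < r / (L + 1) by rewrite divr_gt0.
exists ((r / (L + 1)) *: w); split.
  by rewrite scaler_eq0 negb_or w0 gt_eqF.
apply: normal_vectorZ => //; rewrite -/L gtr0_norm // mulrAC ltr_pdivrMr //.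
by rewrite ltr_pM2l // ltrDl.
Qed.

(** The default value of the exponential map, for a metric without one, is the
projection (x, v) |-> x; it is not injective on the normal disc bundle. *)
Lemma exp_map_is_exp : is_exp X rho (exp_map X rho).
Proof.
have [/xgetPex H|H] := pselect (exists E, is_exp X rho E); first exact: H.
have E q : exp_map X rho q = q.1.
  by rewrite /exp_map xgetPN // => F FE; apply: H; exists F.
have [v [v0 vn]] := exists_normal 0.
have [|_ vz] := exp_map_inj vn (normal_vector0 0); first by rewrite !E.
by rewrite vz eqxx in v0.
Qed.

Lemma exp_map0 x : exp_map X rho (x, 0) = x.
Proof. by have [_ + _] := exp_map_is_exp x 0; rewrite scaler0. Qed.

Section Lift.
Variables (U : set M) (s : M -> R) (t : R).
Hypotheses (U_open : open U) (Ut : U (gamma t)) (s_smooth : smooth_fun X U s).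
Hypothesis s_foot : forall y, U y -> foot X rho gamma r y (s y).

(** The point gamma y is its own foot, so s (gamma y) - y is integer valued
and continuous, hence locally constant. *)
Lemma differential_lift_velocity :
  pairing (velocity X gamma t) (differential X s (gamma t)) = 1.
Proof.
have sm := adm_smooth gamma_adm.
have [ds ->] := differential_curve openT sm I U_open s_smooth Ut.
pose k y := s (gamma y) - y.
have kc : {for t, continuous k}.
  by apply: cvgB; [exact: differentiable_continuous ds|exact: cvg_id].
have kint : \forall y \near t, k y \is a Num.int.
  apply: filterS (near_smooth_dom openT sm I U_open Ut) => y [_ Uy].
  apply: (foot_int (normal_vector0 y)); rewrite exp_map0; exact: s_foot.
rewrite (@near_eq_derive _ _ _ _ (fun y => y + k t)).
  by rewrite deriveD // derive_cst addr0 derive_id.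
by apply: filterS (near_int_cst kc kint) => y <-; rewrite /k /= addrC subrK.
Qed.

(** The geodesic exp(y v) issuing from gamma t stays in one fibre of the normal
bundle, so its feet are t modulo integers and s is locally constant along it. *)
Lemma differential_lift_normal v :
  inner rho (gamma t) v (velocity X gamma t) = 0 ->
  pairing v (differential X s (gamma t)) = 0.
Proof.
move=> vn; have := exp_map_is_exp (gamma t) v.
set sigma := (fun _ => _) => -[[sm _] sigma0 v0].
have Us : U (sigma 0) by rewrite sigma0.
rewrite -sigma0; have [ds] := differential_curve openT sm I U_open s_smooth Us.
rewrite v0 => ->.
pose k y := s (sigma y) - t.
have kc : {for 0, continuous k}.
  by apply: cvgB; [exact: differentiable_continuous ds|exact: cvg_cst].
set L := Num.sqrt (inner rho (gamma t) v v).
have small : \forall y \near (0 : R), `|y| * L < r.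
  have : {for (0 : R), continuous (fun y : R => `|y| * L)}.
    by apply: cvgMl; apply: cvg_norm; exact: cvg_id.
  move=> /cvgr_lt; rewrite normr0 mul0r; apply; exact: r_gt0.
have kint : \forall y \near 0, k y \is a Num.int.
  near=> y; apply: (@foot_int t (y *: v)).
    by apply: normal_vectorZ => //; near: y.
  apply: s_foot; near: y.
  by apply: filterS (near_smooth_dom openT sm I U_open Us) => y [].
rewrite (@near_eq_derive _ _ _ _ (fun=> k 0 + t)) ?derive_cst //.
by apply: filterS (near_int_cst kc kint) => y <-; rewrite /k /= subrK.
Unshelve. all: by end_near. Qed.

End Lift.

(** The prescribed dual norm is nonzero, which excludes the default value 0 of ds:
the covector comes from a smooth lift of the foot map. *)
Lemma core_speed (g : metric R n M) (e t : R) :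
  riemannian X g -> conformal X g rho -> 0 < e ->
  dual_norm2 g (gamma t) (ds X rho gamma r (gamma t)) = (e ^+ 2)^-1 ->
  speed X g gamma t = e.
Proof.
move=> g_riem [f [_ f0 gE]] e0.
have innerE x u v : inner g x u v = f x * inner rho x u v.
  by rewrite /inner gE -scalemxAr -scalemxAl mxE.
rewrite /ds; case: xgetP => [a _ [U [s [Uo Ut sm sf ->]]]|_]; last first.
  rewrite /dual_norm2 mulmx0 mxE => /esym/eqP.
  by rewrite invr_eq0 expf_eq0 /= gt_eqF.
rewrite (dual_norm2_normalized g_riem (adm_regular gamma_adm t)).
- by move=> /invr_inj uu; rewrite /speed uu sqrtr_sqr gtr0_norm.
- exact: (differential_lift_velocity Uo).
move=> v; rewrite innerE => /eqP; rewrite mulf_eq0 gt_eqF //= => /eqP vn.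
exact: (differential_lift_normal Uo).
Qed.

End Core.

(** * Integer classes *)

Section IntegerClasses.
Context (R : realType) (T : topologicalType).

Lemma integer_classD (v w : H1 R T) :
  integer_class v -> integer_class w -> integer_class (v + w).
Proof.
move=> [y [yi ->]] [z [zi ->]]; exists (y + z); rewrite hclass_add; split=> // s.
by rewrite freeg.coeffD rpredD.
Qed.

Lemma integer_classZ (k : int) (v : H1 R T) :
  integer_class v -> integer_class (k%:~R *: v).
Proof.
move=> [z [zi ->]]; exists (k%:~R *: z); split; last exact: hscale_class.
by move=> s; rewrite freeg.coeffZ rpredM // rpred_int.
Qed.

Lemma integer_class_comb m (u : 'I_m -> H1 R T) (k : 'I_m -> int) :
  (forall i, integer_class (u i)) -> integer_class (\sum_i (k i)%:~R *: u i).
Proof.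
move=> ui; elim/big_ind : _ => [|v w|i _]; [|exact: integer_classD|].
  by exists 0; split=> [s|]; [rewrite freeg.coeff0 rpred0|rewrite /hclass raddf0].
exact: integer_classZ.
Qed.

End IntegerClasses.

(** * The two inequalities for Hedlund metrics *)

Section Hedlund.
Context (R : realType) (n : nat) (M : topologicalType) (X : manifold R n M).
Variables (rho g : metric R n M) (P : set (H1 R M)) (h : hedlund_data X P rho).
Hypotheses (n_gt1 : (1 < n)%N) (rho_riem : riemannian X rho).
Hypothesis hg : hedlund_metric h g.

Lemma core_curve_length (i : 'I_(nv h)) : curve_length X g (crv i) = scl i.
Proof.
have rad0 : 0 < rad h by have /andP[e0 er] := eps_rad h; exact: lt_trans er.
transitivity (\int[lebesgue_measure]_(t in `[0, 1]) scl i)%R.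
  apply: eq_Rintegral => t; rewrite inE /= in_itv /= => t01.
  apply: (core_speed n_gt1 rho_riem (crv_admissible i) rad0 (crv_tubular i)).
  - exact: hed_riemannian hg.
  - exact: hed_conformal hg.
  - exact: scl_gt0.
  - exact: hed_core hg i t t01.
rewrite Rintegral_cst //= lebesgue_measure_itv /= lte_fin ltr01 oppr0 adde0.
by rewrite mulr1.
Qed.

(** The infimum is tested on the core curve with multiplicity one. *)
Lemma stable_value_core (i : 'I_(nv h)) : stable_value X g (vint i) <= scl i.
Proof.
have adm := crv_admissible i.
apply: ge_inf.
  exists 0 => _ [m [gamma [_ _ _ ->]]].
  by rewrite mulr_ge0 ?invr_ge0 // curve_length_ge0.
exists 1%N, (crv i); rewrite invr1 mul1r core_curve_length scale1r; split=> //.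
  split; last by rewrite -(adm_periodic adm 0) add0r.
  (* One smooth piece, on the partition 0 < 1. *)
  exists 1%N, (fun k => k%:R); split=> // -[|//] _; split; first exact: ltr01.
  exists setT, (crv i); split=> //; [exact: openT|exact: adm_smooth adm].
exact: crv_represents.
Qed.

Lemma lam_vtx_le1 (j : 'I_(nf h)) (i : 'I_(nv h)) : `|lam j (vtx i)| <= 1.
Proof.
have le1 v : vertex P v -> lam j v <= 1.
  move=> vv; have [vj|vj] := pselect (fct j v).
    by rewrite (lam_eq1 vv vj).
  exact: ltW (lam_lt1 vv vj).
rewrite ler_norml -lerNl -linearN !le1 //; apply/(vtxP h); exists i; [by left|by right].
Qed.

Lemma dual_norm_eta (j : 'I_(nf h)) x : dual_norm2 g x (eta j x) <= 1.
Proof.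
have [[i xi]|xout] :=
    pselect (exists i : 'I_(nv h), tube X rho (crv i) (eps h) x); last first.
  by apply: (hed_outside hg) => i xi; apply: xout; exists i.
rewrite (good_tube (eta_good j) xi) dual_norm2Z vintE linearZ /= exprMn.
have s0 : 0 < scl i ^+ 2 by rewrite exprn_gt0 // scl_gt0.
have := hed_max hg xi; rewrite -[leRHS]mul1r ler_pdivlMr //.
have : lam j (vtx i) ^+ 2 <= 1.
  by rewrite -real_normK ?num_real // expr_le1 // lam_vtx_le1.
have := sqr_ge0 (lam j (vtx i)).
set L := lam j _ ^+ 2; set D := dual_norm2 _ _ _; set S := scl i ^+ 2.
by nra.
Qed.

Lemma lam_le_length (j : 'I_(nf h)) gamma v :
  closed_curve X gamma -> represents gamma v ->
  lam j v <= curve_length X g gamma.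
Proof.
move=> cg rg; rewrite -(good_class (eta_good j) cg rg).
by apply: (line_integral_le (hed_riemannian hg) cg.1); exact: dual_norm_eta.
Qed.

(** If no multiple of v is represented by a closed curve, the infimum is that
of the empty set, which is 0; then N v = 0 and v = 0. *)
Lemma lam_le_stable_norm N (j : 'I_(nf h)) v :
  is_stable_norm X g N -> integer_class v -> lam j v <= N v.
Proof.
move=> NP vi; rewrite (stable_integer NP vi) /stable_value.
set S := [set _ | _]; have [/eqP S0|/set0P S0] := boolP (S == set0).
  have v0 : v = 0.
    by apply: (stable_eq0 NP); rewrite (stable_integer NP vi) /stable_value -/S S0 inf0.
  by rewrite v0 linear0 S0 inf0.
apply: lb_le_inf S0 _ => _ [m [gamma [m0 cg rg ->]]].
have m0R : 0 < m%:R :> R by rewrite ltr0n.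
rewrite ler_pdivlMl //; have := lam_le_length j cg rg.
by rewrite linearZ.
Qed.

End Hedlund.

Theorem theorem3p5 (R : realType) (n : nat) (M : topologicalType)
  (X : manifold R n M) (rho g : metric R n M) (P : set (H1 R M))
  (h : hedlund_data X P rho) (N : H1 R M -> R) :
  (3 <= n)%N -> compact [set: M] -> connected [set: M] -> riemannian X rho ->
  (exists v : H1 R M, v <> 0) ->
  admissible_polytope P ->
  hedlund_metric h g ->
  is_stable_norm X g N ->
  P = [set w | N w <= 1].
Proof.
move=> n3 _ _ rho_riem _ [Ppoly Psym Pint Prat] hg NP.
have n2 : (1 < n)%N by exact: ltnW.
have [m [p [PE pv]]] := polytope_vertices Ppoly.
have N0 : N 0 = 0 by rewrite -(scale0r 0) (stable_scale NP) normr0 mul0r.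
have N_vtx v : vertex P v -> N v <= 1.
  have N_core (i : 'I_(nv h)) : N (vtx i) <= 1.
    have := stable_value_core n2 rho_riem hg i.
    rewrite -(stable_integer NP (vint_indivisible i).1) vintE (stable_scale NP).
    by rewrite gtr0_norm ?scl_gt0 // ger_pMr // scl_gt0.
  move=> /(vtxP h)[i [->//|->]].
  by rewrite -scaleN1r (stable_scale NP) normrN normr1 mul1r.
rewrite eqEsubset; split=> w /=.
  rewrite PE => -[a [a0 a1 ->]].
  rewrite (le_trans (subadditive_sum _ N0 (stable_triangle NP))) // -a1.
  apply: ler_sum => i _.
  by rewrite (stable_scale NP) ger0_norm // ler_piMr // N_vtx.
move=> Nw; apply: contrapT => Pw.
have [f [f_facet fw f_uniq]] := polytope_facet Ppoly Pint Psym Pw.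
have [j jE] := (fctP h _).1 f_facet.
have lam_f : forall x, lam j x = f x.
  apply: f_uniq => v vv fv; apply: lam_eq1 => //; rewrite -jE; split=> //.
  by case: vv.
have /(_ w) : forall w, lam j w <= N w.
  have [c /choice[u /all_and3[_ ui pE]]] := choice (fun i => Prat _ (pv i)).
  apply: (scalar_le_of_int_comb (stable_triangle NP) (stable_scale NP) (u := u)).
    move=> x; have [|a ->] := @interior_spans _ _ _ p _ x; first by rewrite -PE.
    by exists (fun i => a i * c i); apply: eq_bigr => i _; rewrite -scalerA -pE.
  move=> k /=; apply: (lam_le_stable_norm hg j NP).
  exact: integer_class_comb.
by rewrite lam_f leNgt => /negP; apply; exact: le_lt_trans fw.
Qed.
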